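(* Let $d\ge 2$ and $n\ge 1$ be integers and let $x_1,\ldots,x_n\in\mathbb{R}^d$ be deterministic vectors, not all zero. Define $\sigma>0$ by $\frac{1}{n}\sum_{i=1}^n|x_i|^2=\sigma^2 d$. Suppose $A,B$ are constants such that $$\frac{1}{n}\sum_{i=1}^n\big|\sigma^{-2}|x_i|^2-d\big|\le A$$ and, for all $\theta\in\mathbb{S}^{d-1}$, $$\frac{1}{n}\sum_{i=1}^n\langle\theta,x_i\rangle^2\le B.$$ For $\theta\in\mathbb{S}^{d-1}$, let $\mu_n^\theta$ be the probability measure on $\mathbb{R}$ putting mass $\frac1n$ at each of the points $\langle\theta,x_1\rangle,\ldots,\langle\theta,x_n\rangle$. Let $\theta$ be distributed uniformly on $\mathbb{S}^{d-1}$. If $$B\ge\epsilon\ge\max\left(\left[\frac{3\cdot 2^6\pi B}{\sqrt{d-1}}\right]^{2/5},\frac{2(A+2)}{d-1}\right),$$ then $$\mathbb{P}\left[d_{BL}\big(\mu_n^\theta,\mathcal{N}(0,\sigma^2)\big)>\epsilon\right]\le\frac{c_1\sqrt{B}}{\epsilon^{3/2}}\exp\left[-\frac{c_2(d-1)\epsilon^5}{B^2}\right],$$ where $c_1=48\sqrt{\pi}$ and $c_2=3^{-2}2^{-16}$.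
   Context: $\mathbb{S}^{d-1}$ denotes the unit sphere in $\mathbb{R}^d$, $\langle\cdot,\cdot\rangle$ the standard inner product, and ''uniformly'' refers to the normalized rotation-invariant surface measure on $\mathbb{S}^{d-1}$. $\mathcal{N}(0,\sigma^2)$ is the centered Gaussian distribution with variance $\sigma^2$. For $f:\mathbb{R}\to\mathbb{R}$, $\|f\|_{BL}:=\|f\|_\infty+\sup_{x\neq y}\frac{|f(x)-f(y)|}{|x-y|}$, and the bounded-Lipschitz distance between probability measures $\mu,\nu$ on $\mathbb{R}$ is $d_{BL}(\mu,\nu)=\sup_{\|f\|_{BL}\le1}\left|\int f\,d\mu-\int f\,d\nu\right|$. *)

(* Defs.v *)
From HB Require Import structures.
From mathcomp Require Import all_boot all_order all_algebra.
From mathcomp Require Import all_classical all_reals all_analysis.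

Set Implicit Arguments.
Unset Strict Implicit.
Unset Printing Implicit Defensive.

Import Order.TTheory GRing.Theory Num.Theory.
Import numFieldNormedType.Exports.

Local Open Scope classical_set_scope.
Local Open Scope ring_scope.

Section Defs.
Variable R : realType.

Definition dotp (d : nat) (u v : 'rV[R]_d) : R := \sum_(j < d) u 0 j * v 0 j.
Definition sqnorm (d : nat) (u : 'rV[R]_d) : R := \sum_(j < d) u 0 j ^+ 2.

Definition unit_sphere (d : nat) : set 'rV[R]_d := [set u | sqnorm u = 1].
Definition unit_ball (d : nat) : set 'rV[R]_d := [set u | sqnorm u <= 1].
Arguments unit_sphere : clear implicits.
Arguments unit_ball : clear implicits.

(* d-dimensional Lebesgue integral of a nonnegative function, as an iterated
   one-dimensional Lebesgue integral (Tonelli): coordinates 0..n-1 of the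
   argument are integrated over R, one after the other. *)
Fixpoint iter_leb_int (n : nat) (f : (nat -> R) -> \bar R) : \bar R :=
  match n with
  | 0%N => f (fun _ => 0)
  | n'.+1 => (\int[@lebesgue_measure R]_x
                iter_leb_int n' (fun v => f (fun j => if j == n' then x else v j)))%E
  end.

Definition leb_vol (d : nat) (E : set 'rV[R]_d) : \bar R :=
  iter_leb_int d (fun v => (\1_E (\row_(j < d) v j) : R)%:E).

Definition cone (d : nat) (S : set 'rV[R]_d) : set 'rV[R]_d :=
  [set u | exists r theta, 0 < r <= 1 /\ S theta /\ u = r *: theta].

(* normalized rotation-invariant (uniform) probability on S^{d-1}, given by
   the cone measure: sigma(S) = vol(cone S) / vol(unit ball). *)
Definition sphere_prob (d : nat) (S : set 'rV[R]_d) : R :=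
  fine (leb_vol (cone (S `&` unit_sphere d))) / fine (leb_vol (unit_ball d)).

Definition BL_le1 (f : R -> R) : Prop :=
  exists M L : R, (forall x, `|f x| <= M) /\
    (forall x y, `|f x - f y| <= L * `|x - y|) /\ M + L <= 1.

Definition emp_proj_int (n d : nat) (x : 'I_n -> 'rV[R]_d) (theta : 'rV[R]_d)
  (f : R -> R) : R := n%:R^-1 * \sum_(i < n) f (dotp theta (x i)).

Definition dBL_proj_normal (n d : nat) (x : 'I_n -> 'rV[R]_d) (theta : 'rV[R]_d)
  (sigma : R) : R :=
  sup [set r : R | exists f : R -> R, BL_le1 f /\
     r = `| emp_proj_int x theta f
            - fine (\int[normal_prob 0 sigma]_y (f y)%:E)%E |].

End Defs.

Arguments unit_sphere {R} d.
Arguments unit_ball {R} d.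
Arguments sphere_prob {R} {d}.

(* Main.v *)
(* A uniform point of the sphere is v / |v| with v a standard Gaussian vector,
   and v / |v| is within O(delta) of v / sqrt d outside a set of exponentially
   small probability, by a Chernoff bound on |v|^2.  The test functions are
   reduced to finitely many: on [-T, T] a bounded Lipschitz f is uniformly close
   to its piecewise linear interpolant, which is a combination, with
   coefficients at most Lip f, of N ramp functions.  The average of a ramp over
   the points <v, x_i> / sqrt d is a sqrt (B / d)-Lipschitz function of v, so it
   concentrates around its Gaussian mean; this follows from the one-dimensional
   Prekopa-Leindler inequality, tensorised in the form "a(u) b(v) <= K
   exp (|u - v|^2 / 4) implies E a E b <= K".  Finally the mixture of the
   centred normal laws with variances |x_i|^2 / d is within O(A / d) of
   N(0, sigma^2), because the density of N(0, b^2) dominates a / b times that of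
   N(0, a^2) for a <= b. *)
Require Import Defs.
From HB Require Import structures.
From mathcomp Require Import all_boot all_order all_algebra.
From mathcomp Require Import all_classical all_reals all_analysis.
From mathcomp Require Import measurable_realfun.
From mathcomp Require Import ring lra.

Import Order.TTheory GRing.Theory Num.Theory.
Import numFieldNormedType.Exports.

Local Open Scope classical_set_scope.
Local Open Scope ring_scope.

Set Implicit Arguments.
Unset Strict Implicit.
Unset Printing Implicit Defensive.

(** The event is a set whose measurability is never established, since the supremum in the distance
    runs over uncountably many test functions. This is harmless because [leb_vol] is an iterated
    integral of nonnegative functions, monotone without any measurability: it is enough to dominate
    the event by a measurable function of v that is homogeneous of degree 0. The indicator that the
    ramp averages taken at v / |v| deviate too much is such a function. Ramps serve as building
    blocks rather than hat functions because the variations of the N ramps between two points add up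
    to at most the distance of these points; passing from v / |v| to v / sqrt d then costs no factor
    N. The shape of the bound comes from the grid. Mesh of order eps and half-width of order sqrt (B
    / eps) give N of order sqrt B / eps^(3/2), which the union bound turns into the prefactor. Each
    ramp may deviate by eps / (10 N) with Lipschitz constant sqrt (B / d), so the exponent is of
    order d eps^2 / (B N^2), that is d eps^5 / B^2. The error budget is kept separately for Lip f
    and sup f, and the two are recombined only at the end through their sum being at most 1. *)

(** * Iterated integrals over finitely many coordinates: measurability, Tonelli, linearity *)

Section IteratedIntegrals.
Local Open Scope ereal_scope.
Context {R : realType}.
Local Notation RM := (measurableTypeR R).

Import HBNNSimple.

(* Unlike [ge0_le_integral], no measurability is required. *)
Lemma ge0_le_int d (T : measurableType d) (mu : {measure set T -> \bar R})
    (f g : T -> \bar R) :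
  (forall x, 0 <= f x) -> (forall x, f x <= g x) ->
  \int[mu]_x f x <= \int[mu]_x g x.
Proof.
move=> f0 fg.
have g0 x : 0 <= g x by exact: le_trans (f0 x) (fg x).
rewrite /integral !patch_setT; apply: leeB.
  apply: ereal_sup_le => _ [h hf <-].
  exists h => // x; apply: (le_trans (hf x)).
  by rewrite !(@ge0_funeposE _ _ setT) ?inE.
rewrite (_ : g^\- = f^\-)//; apply/funext => x.
by rewrite !(@ge0_funenegE _ _ setT) ?inE.
Qed.

Definition upd (n : nat) (x : R) (v : nat -> R) : nat -> R :=
  fun j => if j == n then x else v j.

(** The recursion of [iter_leb_int] with the measure as a parameter, so that Lebesgue and Gaussian
    integrals share one theory. Coordinates of index at least [n] are frozen at 0. *)
Fixpoint itint (mu : {sigma_finite_measure set RM -> \bar R}) (n : nat)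
    (f : (nat -> R) -> \bar R) : \bar R :=
  match n with
  | 0%N => f (fun _ => 0%R)
  | n'.+1 => \int[mu]_x itint mu n' (fun v => f (upd n' x v))
  end.

(* Joint measurability of a parametrised function of finitely or infinitely
   many real coordinates, tested on all measurable parameter spaces; this
   replaces a sigma-algebra on [nat -> R]. *)
Definition jmeas d0 (Om0 : measurableType d0) (f : Om0 -> (nat -> R) -> \bar R) :=
  forall d (Om : measurableType d) (p : Om -> Om0) (c : nat -> Om -> R),
    measurable_fun setT p -> (forall j, measurable_fun setT (c j)) ->
    measurable_fun setT ((fun w => f (p w) (fun j => c j w)) : Om -> \bar R).

Definition cmeas (f : (nat -> R) -> \bar R) :=
  forall d (Om : measurableType d) (c : nat -> Om -> R),
    (forall j, measurable_fun setT (c j)) ->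
    measurable_fun setT ((fun w => f (fun j => c j w)) : Om -> \bar R).

Lemma jmeas_at d0 (Om0 : measurableType d0) f w : jmeas (Om0 := Om0) f -> cmeas (f w).
Proof. by move=> mf d Om c mc; apply: (mf d Om (fun=> w) c). Qed.

Lemma jmeas_upd d0 (Om0 : measurableType d0) f n : jmeas (Om0 := Om0) f ->
  jmeas (Om0 := (Om0 * RM)%type) (fun wx v => f wx.1 (upd n wx.2 v)).
Proof.
move=> mf d Om p c mp mc.
apply: (mf d Om (fun w => (p w).1) (fun j w => if j == n then (p w).2 else c j w)).
  exact: measurableT_comp.
move=> j; case: (j == n) => //.
exact: (measurableT_comp (@measurable_snd _ _ Om0 RM) mp).
Qed.

Lemma cmeas_upd f n : cmeas f -> jmeas (Om0 := RM) (fun x v => f (upd n x v)).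
Proof.
move=> mf d Om p c mp mc.
by apply: (mf d Om (fun j w => if j == n then p w else c j w)) => j; case: eqP.
Qed.

Lemma cmeas_updx f n x : cmeas f -> cmeas (fun v => f (upd n x v)).
Proof.
move=> mf d Om c mc.
by apply: (mf d Om (fun j w => if j == n then x else c j w)) => j; case: eqP.
Qed.

Lemma itint_ge0 mu n f : (forall v, 0 <= f v) -> 0 <= itint mu n f.
Proof. by elim: n f => //= n IH f f0; apply: integral_ge0 => x _; exact: IH. Qed.

Lemma le_itint mu n f g : (forall v, 0 <= f v) -> (forall v, f v <= g v) ->
  itint mu n f <= itint mu n g.
Proof.
elim: n f g => //= n IH f g f0 fg; apply: ge0_le_int => x.
  exact: itint_ge0.
exact: IH.
Qed.

Lemma eq_itint mu n f g : (forall v, f v = g v) -> itint mu n f = itint mu n g.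
Proof. by move=> fg; congr (itint mu n _); apply/funext. Qed.

(** The induction changes the parameter space: the outermost coordinate joins the parameter, [Om0]
    becoming [Om0 * RM], and is then integrated out by Fubini-Tonelli. This is why [jmeas] must be
    available over every parameter space. *)
Lemma measurable_itint mu n d0 (Om0 : measurableType d0) f :
  (forall w v, 0 <= f w v) -> jmeas (Om0 := Om0) f ->
  measurable_fun setT (fun w => itint mu n (f w)).
Proof.
elim: n d0 Om0 f => [|n IH] d0 Om0 f f0 mf /=.
  exact: (mf d0 Om0 id (fun _ _ => 0%R)).
have mF := IH _ _ (fun (wx : Om0 * RM) v => f wx.1 (upd n wx.2 v)) (fun wx v => f0 _ _)
  (@jmeas_upd _ _ _ n mf).
apply: (measurable_fun_fubini_tonelli_F (m2 := mu)
  (fun wx : Om0 * RM => itint mu n (fun v => f wx.1 (upd n wx.2 v)))) => //.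
by move=> x; exact: itint_ge0.
Qed.

(** [nu] is moved past one coordinate at a time. The application is the exchange of the
    n-dimensional integral with the level variable of a layer-cake formula. *)
Lemma itint_tonelli mu n d0 (Om0 : measurableType d0)
    (nu : {sigma_finite_measure set Om0 -> \bar R}) f :
  (forall w v, 0 <= f w v) -> jmeas (Om0 := Om0) f ->
  \int[nu]_w itint mu n (f w) = itint mu n (fun v => \int[nu]_w f w v).
Proof.
elim: n d0 Om0 nu f => [|n IH] d0 Om0 nu f f0 mf //=.
have mF := measurable_itint mu n (f := fun (wx : Om0 * RM) v => f wx.1 (upd n wx.2 v))
  (fun wx v => f0 _ _) (@jmeas_upd _ _ _ n mf).
rewrite (fubini_tonelli (m1 := nu) (m2 := mu)
  (fun wx : Om0 * RM => itint mu n (fun v => f wx.1 (upd n wx.2 v))))//=; last first.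
  by move=> x; exact: itint_ge0.
apply: eq_integral => x _; apply: (IH _ _ _ (fun w v => f w (upd n x v))) => //.
move=> d Om p c mp mc.
apply: (mf d Om p (fun j w => if j == n then x else c j w)) => // j.
by case: eqP.
Qed.

Lemma itintD mu n f g : (forall v, 0 <= f v) -> (forall v, 0 <= g v) ->
  cmeas f -> cmeas g ->
  itint mu n (fun v => f v + g v) = itint mu n f + itint mu n g.
Proof.
elim: n f g => //= n IH f g f0 g0 mf mg.
under eq_integral => x _.
  rewrite IH//; last 2 first.
  - exact: cmeas_updx.
  - exact: cmeas_updx.
  over.
rewrite ge0_integralD//=.
- by move=> x _; exact: itint_ge0.
- by apply: measurable_itint => //; exact: cmeas_upd.
- by move=> x _; exact: itint_ge0.
- by apply: measurable_itint => //; exact: cmeas_upd.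
Qed.

Lemma itintZ mu n (k : \bar R) f : 0 <= k -> (forall v, 0 <= f v) -> cmeas f ->
  itint mu n (fun v => k * f v) = k * itint mu n f.
Proof.
move=> k0; elim: n f => //= n IH f f0 mf.
under eq_integral => x _.
  rewrite IH//; last exact: cmeas_updx.
  over.
rewrite ge0_integralZl//=.
- by apply: measurable_itint => //; exact: cmeas_upd.
- by move=> x _; exact: itint_ge0.
Qed.

Lemma itint0 mu n : itint mu n (fun=> 0) = 0.
Proof.
elim: n => //= n IH; rewrite -[RHS](integral0 mu setT).
exact: eq_integral.
Qed.

Lemma itint_sum mu n (I : Type) (r : seq I) (f : I -> (nat -> R) -> \bar R) :
  (forall i v, 0 <= f i v) -> (forall i, cmeas (f i)) ->
  itint mu n (fun v => \sum_(i <- r) f i v) = \sum_(i <- r) itint mu n (f i).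
Proof.
move=> f0 mf; elim: r => [|i r IH].
  rewrite big_nil -[RHS](itint0 mu n); apply: eq_itint => v.
  by rewrite big_nil.
rewrite big_cons -IH -itintD//.
- by apply: eq_itint => v; rewrite big_cons.
- by move=> v; exact: sume_ge0.
- move=> d Om c mc; apply: emeasurable_sum => j; exact: mf.
Qed.

Lemma iter_leb_intE n f : iter_leb_int n f = itint (@lebesgue_measure R) n f.
Proof. by elim: n f => //= n IH f; apply: eq_integral => x _; exact: IH. Qed.

End IteratedIntegrals.

(** * Affine substitution for Lebesgue measure, and integration against a normal density *)

Section AffineSubstitution.
Local Open Scope ereal_scope.
Import HBNNSimple.
Context {R : realType}.
Local Notation RM := (measurableTypeR R).
Local Notation mu := (@lebesgue_measure R).

Let aff (a b : R) : RM -> RM := fun x => (a * x + b)%R.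

Let maff a b : measurable_fun setT (aff a b).
Proof. by apply: measurable_funD => //; exact: measurable_funM. Qed.

(** By uniqueness of Lebesgue measure it suffices that [|a|] times the push-forward gives half-open
    intervals their length. For [a < 0] the preimage of such an interval is half-open on the other
    side, with the same length. *)
Lemma lebesgue_measure_affine (a b : R) (A : set RM) : a != 0%R -> measurable A ->
  mu (aff a b @^-1` A) = (`|a|^-1)%:E * mu A.
Proof.
move=> a0 mA.
have aa0 : (0 <= `|a|)%R by [].
pose m0 : {measure set RM -> \bar R} := mscale (NngNum aa0) (pushforward mu (aff a b)).
pose m := m0 (maff a b).
have mE B : m B = `|a|%:E * mu (aff a b @^-1` B) by [].
have -> : mu A = m A; last first.
  by rewrite mE muleA -EFinM mulVf ?mul1e// normr_eq0.
apply: (@lebesgue_measure_unique R m) => //= _ [[x y] /= xy <-].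
rewrite mE.
have [ap|an] := ltP 0%R a.
  have -> : aff a b @^-1` `]x, y] = `]((x - b) / a)%R, ((y - b) / a)%R]%classic.
    apply/seteqP; split => z /=; rewrite !in_itv/= /aff.
      by rewrite ltr_pdivrMr// ler_pdivlMr// ltrBlDr lerBrDr mulrC.
    by rewrite ltr_pdivrMr// ler_pdivlMr// ltrBlDr lerBrDr [(z * a)%R]mulrC.
  rewrite !lebesgue_measure_itv/= !lte_fin ltr_pM2r ?invr_gt0// ltrD2r.
  case: ifP => _; last by rewrite mule0.
  rewrite -!EFinD -EFinM gtr0_norm//; congr (_%:E); field.
  by rewrite gt_eqF.
have {}an : (a < 0)%R by rewrite lt_neqAle a0.
have -> : aff a b @^-1` `]x, y] = `[((y - b) / a)%R, ((x - b) / a)%R[%classic.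
  apply/seteqP; split => z /=; rewrite !in_itv/= /aff.
    by rewrite ltr_ndivlMr// ler_ndivrMr// ltrBlDr lerBrDr [(z * a)%R]mulrC andbC.
  by rewrite ltr_ndivlMr// ler_ndivrMr// ltrBlDr lerBrDr [(z * a)%R]mulrC andbC.
rewrite !lebesgue_measure_itv/= !lte_fin ltr_nM2r ?invr_lt0// ltrD2r.
case: ifP => _; last by rewrite mule0.
rewrite -!EFinD -EFinM ltr0_norm//; congr (_%:E); field.
by rewrite lt_eqF.
Qed.

Lemma integral_affine (a b : R) (f : RM -> \bar R) : a != 0%R ->
  measurable_fun setT f -> (forall x, 0 <= f x) ->
  \int[mu]_x f (a * x + b)%R = (`|a|^-1)%:E * \int[mu]_x f x.
Proof.
move=> a0 mf f0.
have aa0 : (0 <= `|a|^-1)%R by rewrite invr_ge0.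
rewrite -(@ge0_integral_mscale _ _ _ mu setT _ (NngNum aa0))//.
transitivity (\int[pushforward mu (aff a b)]_x f x).
  by rewrite (ge0_integral_pushforward (maff a b))//= preimage_setT.
pose m1 : {measure set RM -> \bar R} := pushforward mu (aff a b).
pose m2 : {measure set RM -> \bar R} := mscale (NngNum aa0) mu.
apply: (@eq_measure_integral _ _ _ _ m2 (m1 (maff a b))) => A mA _.
exact: lebesgue_measure_affine.
Qed.

(** On indicators the formula is the definition of [normal_prob]; linearity extends it to simple
    functions and monotone convergence to [f]. *)
Lemma integral_normal_prob (m s : R) (f : RM -> \bar R) :
  measurable_fun setT f -> (forall x, 0 <= f x) ->
  \int[normal_prob m s]_x f x = \int[mu]_x ((normal_pdf m s x)%:E * f x).
Proof.
move=> mf f0.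
have mp : measurable_fun setT (fun x : RM => (normal_pdf m s x)%:E).
  by apply/measurable_EFinP; exact: measurable_normal_pdf.
pose f_ := nnsfun_approx measurableT mf.
have cvf x : (f_ n x)%:E @[n --> \oo] --> f x by exact: cvg_nnsfun_approx.
transitivity (limn (fun n => \int[normal_prob m s]_x (f_ n x)%:E)).
  rewrite -monotone_convergence//.
  - by apply: eq_integral => x _; apply/esym/cvg_lim.
  - by move=> n; exact/measurable_EFinP.
  - by move=> n x _; rewrite lee_fin.
  - by move=> x _ i j ij; rewrite lee_fin; exact/lefP/nd_nnsfun_approx.
transitivity (limn (fun n => \int[mu]_x ((normal_pdf m s x)%:E * (f_ n x)%:E))); last first.
  rewrite -monotone_convergence//.
  - apply: eq_integral => x _; apply/cvg_lim => //.
    by apply: cvgeZl.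
  - by move=> n; apply: emeasurable_funM => //; exact/measurable_EFinP.
  - by move=> n x _; rewrite mule_ge0// lee_fin ?normal_pdf_ge0.
  - move=> x _ i j ij; rewrite lee_wpmul2l ?lee_fin ?normal_pdf_ge0//.
    exact/lefP/nd_nnsfun_approx.
congr (limn _); apply/funext => n.
under eq_integral do rewrite fimfunE -fsumEFin//.
rewrite ge0_integral_fsum//; last 2 first.
- by move=> y; exact/measurable_EFinP/measurable_funM.
- by move=> y x _; rewrite nnfun_muleindic_ge0.
under [RHS]eq_integral.
  move=> x _; rewrite fimfunE -fsumEFin// ge0_mule_fsumr; last first.
    move=> r; by rewrite EFinM nnfun_muleindic_ge0.
  over.
rewrite ge0_integral_fsum//; last 2 first.
- by move=> y; apply: emeasurable_funM => //; exact/measurable_EFinP/measurable_funM.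
- move=> y x _; apply: mule_ge0; first by rewrite lee_fin normal_pdf_ge0.
  by rewrite EFinM nnfun_muleindic_ge0.
apply: eq_fsbigr => r _.
rewrite integralZl_indic_nnsfun// integral_indic//= setIT /normal_prob.
rewrite integral_mkcond.
have [r0|r0] := ltP r 0%R.
  rewrite preimage_nnfun0// patch_set0 integral_cst//= !mul0e mule0.
  under eq_integral do rewrite indicE in_set0 /= mulr0 mule0.
  by rewrite integral_cst// mul0e.
rewrite -ge0_integralZl//; last 2 first.
- apply/(measurable_restrictT _ _).1; last exact: measurable_funTS.
  by [].
- by move=> x _; rewrite /patch; case: ifP => // _; rewrite lee_fin normal_pdf_ge0.
apply: eq_integral => x _; rewrite /patch indicE; case: ifP => _ /=.
  by rewrite mulr1 muleC.
by rewrite mulr0 !mule0.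
Qed.

End AffineSubstitution.

(** * Standard Gaussian integrals: density, scaling, linear forms, exponentials of squares *)

Section GaussianIntegrals.
Local Open Scope ereal_scope.
Context {R : realType}.
Local Notation RM := (measurableTypeR R).
Local Notation mu := (@lebesgue_measure R).
Local Notation gam := (@normal_prob R 0%R 1%R).

Definition sqn (n : nat) (v : nat -> R) : R := (\sum_(j < n) v j ^+ 2)%R.

Lemma sqn_ge0 n v : (0 <= sqn n v)%R.
Proof. by apply: sumr_ge0 => j _; exact: sqr_ge0. Qed.

Lemma upd_ltn n x (v : nat -> R) j : (j < n)%N -> upd n x v j = v j.
Proof. by rewrite /upd; case: eqP => // ->; rewrite ltnn. Qed.

Lemma upd_eq n x (v : nat -> R) : upd n x v n = x.
Proof. by rewrite /upd eqxx. Qed.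

Lemma sqn_upd n x v : sqn n.+1 (upd n x v) = (sqn n v + x ^+ 2)%R.
Proof.
rewrite /sqn big_ord_recr/= upd_eq; congr (_ + _)%R.
by apply: eq_bigr => j _; rewrite upd_ltn.
Qed.

Lemma measurable_sqn n d (Om : measurableType d) (c : nat -> Om -> R) :
  (forall j, measurable_fun setT (c j)) ->
  measurable_fun setT (fun w => sqn n (fun j => c j w)).
Proof.
by move=> mc; apply: measurable_sum => j; exact: measurable_funX.
Qed.

Lemma normal_peakE (s : R) : normal_peak s = (`|s|^-1 * normal_peak 1)%R.
Proof.
rewrite /normal_peak expr1n mul1r -invfM; congr (_^-1)%R.
by rewrite -mulrnAr sqrtrM ?sqr_ge0// sqrtr_sqr.
Qed.

Lemma normal_pdf1E (x : R) :
  normal_pdf 0 1 x = (normal_peak 1 * expR (- (x ^+ 2 / 2)))%R.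
Proof.
rewrite normal_pdfE ?oner_eq0// /normal_fun subr0 expr1n mulNr.
by rewrite mulr2n.
Qed.

Lemma normal_pdfsE (m s x : R) : s != 0%R ->
  normal_pdf m s x =
  (`|s|^-1 * normal_peak 1 * expR (- ((x - m) ^+ 2 / (s ^+ 2 * 2))))%R.
Proof.
move=> s0; rewrite normal_pdfE// /normal_fun mulNr -normal_peakE.
by rewrite mulr_natr.
Qed.

Definition gdens (n : nat) (v : nat -> R) : R :=
  (normal_peak 1 ^+ n * expR (- (sqn n v / 2)))%R.

Lemma gdens_ge0 n v : (0 <= gdens n v)%R.
Proof. by rewrite mulr_ge0 ?expR_ge0// exprn_ge0// normal_peak_ge0. Qed.

Lemma gdens_upd n x v : gdens n.+1 (upd n x v) = (normal_pdf 0 1 x * gdens n v)%R.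
Proof.
rewrite /gdens sqn_upd normal_pdf1E exprS mulrDl opprD expRD.
by rewrite !mulrA -!(mulrA (normal_peak 1)); congr (_ * _)%R; ring.
Qed.

Lemma measurable_gdens n d (Om : measurableType d) (c : nat -> Om -> R) :
  (forall j, measurable_fun setT (c j)) ->
  measurable_fun setT (fun w => gdens n (fun j => c j w)).
Proof.
move=> mc; apply: measurable_funM => //; apply: measurableT_comp => //.
apply: measurableT_comp => //; apply: measurable_funM => //.
exact: measurable_sqn.
Qed.

Lemma cmeas_gdensM n (f : (nat -> R) -> \bar R) : cmeas f ->
  cmeas (fun v => (gdens n v)%:E * f v).
Proof.
move=> mf d Om c mc; apply: emeasurable_funM; last exact: mf.
by apply/measurable_EFinP; exact: measurable_gdens.
Qed.

Lemma itint_gauss n f : (forall v, 0 <= f v) -> cmeas f ->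
  itint gam n f = itint mu n (fun v => (gdens n v)%:E * f v).
Proof.
elim: n f => [|n IH] f f0 mf /=.
  by rewrite /gdens /sqn big_ord0 expr0 mul0r oppr0 expR0 mulr1 mul1e.
have mfx x : cmeas (fun v => f (upd n x v)) := cmeas_updx n x mf.
rewrite integral_normal_prob; first last.
- by move=> x; exact: itint_ge0.
- by apply: measurable_itint => //; exact: cmeas_upd.
apply: eq_integral => x _; rewrite IH// -itintZ.
- by apply: eq_itint => v; rewrite gdens_upd EFinM muleA.
- by rewrite lee_fin normal_pdf_ge0.
- by move=> v; rewrite mule_ge0// lee_fin gdens_ge0.
- exact: cmeas_gdensM.
Qed.

Lemma itint_scale n r f : (0 < r)%R -> (forall v, 0 <= f v) -> cmeas f ->
  (r ^+ n)%:E * itint mu n (fun v => f (fun j => (r * v j)%R)) = itint mu n f.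
Proof.
move=> r0; elim: n f => [|n IH] f f0 mf /=.
  by rewrite expr0 mul1e; congr f; apply/funext => j; rewrite mulr0.
have mfx x : cmeas (fun v => f (upd n x v)) := cmeas_updx n x mf.
have mI : measurable_fun setT (fun x : RM => itint mu n (fun v => f (upd n x v))).
  by apply: measurable_itint => //; exact: cmeas_upd.
have rn0 : (0 <= r ^+ n)%R by rewrite exprn_ge0 ?ltW.
have mfr : cmeas (fun v => f (fun j => (r * v j)%R)).
  move=> d Om c mc; apply: (mf _ _ (fun j w => r * c j w)%R) => j.
  exact: measurable_funM.
have mfru : jmeas (Om0 := RM) (fun x v => f (fun j => (r * upd n x v j)%R)).
  exact: (cmeas_upd n mfr).
rewrite exprSr [(_ * r)%R]mulrC EFinM -muleA -ge0_integralZl//; first last.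
- by move=> x _; exact: itint_ge0.
- exact: measurable_itint.
under eq_integral => x _.
  rewrite (_ : itint _ _ _ = itint mu n (fun v =>
      f (upd n (r * x)%R (fun j => (r * v j)%R)))); last first.
    by apply: eq_itint => v; congr f; apply/funext => j; rewrite /upd; case: eqP.
  rewrite (IH (fun v => f (upd n (r * x)%R v)))//.
  over.
have := @integral_affine R r 0 (fun x => itint mu n (fun v => f (upd n x v))).
rewrite gt_eqF// => /(_ isT mI) intE.
under eq_integral do rewrite -[(r * _)%R]addr0.
rewrite intE; last by move=> x; exact: itint_ge0.
by rewrite gtr0_norm// muleA -EFinM divff ?mul1e// gt_eqF.
Qed.

Lemma gauss_cst (k : \bar R) : \int[gam]_x k = k.
Proof.
rewrite integral_cst; last by [].
rewrite -[RHS]mule1; congr (_ * _).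
exact: (@probability_setT _ _ _ (@normal_prob R 0 1)).
Qed.

Lemma itint_gauss_cst n (k : \bar R) : itint gam n (fun=> k) = k.
Proof.
by elim: n => //= n IH; under eq_integral do rewrite IH; rewrite gauss_cst.
Qed.

Lemma gauss_scale (c : R) (f : RM -> \bar R) : c != 0%R ->
  measurable_fun setT f -> (forall x, 0 <= f x) ->
  \int[gam]_z f (c * z)%R = \int[mu]_z ((normal_pdf 0 `|c| z)%:E * f z).
Proof.
move=> c0 mf f0.
have nc0 : `|c|%R != 0%R by rewrite normr_eq0.
have mfc : measurable_fun setT (fun z : RM => f (c * z)%R).
  by apply: (measurableT_comp mf); exact: measurable_funM.
rewrite (@integral_normal_prob _ 0 1 (fun z => f (c * z)%R)); [|by []|by []].
pose g (z : RM) := ((normal_pdf 0 1 (z / c)%R)%:E * f z).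
transitivity (\int[mu]_x g (c * x + 0)%R).
  by apply: eq_integral => x _; rewrite /g addr0 [(c * x)%R]mulrC mulfK.
have mg : measurable_fun setT g.
  apply: emeasurable_funM => //; apply/measurable_EFinP.
  apply: measurableT_comp; first exact: measurable_normal_pdf.
  exact: measurable_funM.
have g0 x : 0 <= g x by rewrite mule_ge0// lee_fin normal_pdf_ge0.
rewrite integral_affine; [|by []|by []|by []].
rewrite -ge0_integralZl; [|by []|by []|by []|by rewrite lee_fin invr_ge0].
apply: eq_integral => z _; rewrite /g muleA -EFinM; congr (_%:E * _).
rewrite normal_pdf1E normal_pdfsE// mulrA normr_id subr0 real_normK ?num_real//.
by congr (_ * expR (- _))%R; field.
Qed.

Lemma gauss_normal_prob (s : R) (f : RM -> \bar R) : (0 < s)%R ->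
  measurable_fun setT f -> (forall x, 0 <= f x) ->
  \int[gam]_z f (s * z)%R = \int[normal_prob 0 s]_z f z.
Proof.
move=> s0 mf f0; rewrite gauss_scale; [|by rewrite gt_eqF|by []|by []].
by rewrite integral_normal_prob; [rewrite gtr0_norm|by []|by []].
Qed.

(** Stability of the normal law. The inner variable is replaced by z = a x + b y, the integrals are
    exchanged, and x is integrated out. *)
Lemma gauss_sum2 (a b : R) (f : RM -> \bar R) :
  measurable_fun setT f -> (forall x, 0 <= f x) ->
  \int[gam]_x \int[gam]_y f (a * x + b * y)%R =
  \int[gam]_z f (Num.sqrt (a ^+ 2 + b ^+ 2) * z)%R.
Proof.
move=> mf f0.
(* The substitution divides by [b], so [b = 0] is separate; there the sign of [a] is absorbed by
   symmetry. *)
have [->|b0] := eqVneq b 0%R.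
  rewrite expr0n/= addr0 sqrtr_sqr.
  transitivity (\int[gam]_x f (a * x)%R).
    apply: eq_integral => x _.
    under eq_integral do rewrite mul0r addr0.
    by rewrite gauss_cst.
  have [->|a0] := eqVneq a 0%R.
    by rewrite normr0.
  by rewrite !(gauss_scale _ mf f0) ?normr_eq0 ?normr_id.
set c := Num.sqrt _.
have ab0 : (0 < a ^+ 2 + b ^+ 2)%R by rewrite ltr_wpDl ?sqr_ge0// exprn_even_gt0.
have c0 : (0 < c)%R by rewrite sqrtr_gt0.
have c2 : (c ^+ 2 = a ^+ 2 + b ^+ 2)%R by rewrite sqr_sqrtr// ltW.
have nb0 : (0 < `|b|)%R by rewrite normr_gt0.
pose k (x z : R) := (`|b|^-1 * (normal_pdf 0 1 x * normal_pdf 0 1 ((z - a * x) / b)))%R.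
(* [k] is the joint density of x and z. Completing the square factors it into the density of z and
   the conditional density of x given z, whose integral over x is 1. *)
have kE x z : k x z = (normal_pdf 0 c z * normal_pdf (a * z / c ^+ 2) (`|b| / c) x)%R.
  have bc0 : (`|b| / c != 0)%R by rewrite mulf_neq0 ?invr_eq0 ?normr_eq0// gt_eqF.
  rewrite /k !normal_pdf1E (normal_pdfsE _ _ bc0) (normal_pdfsE _ _ (lt0r_neq0 c0)) (gtr0_norm c0).
  rewrite (gtr0_norm (divr_gt0 nb0 c0)) subr0 (exprMn 2 `|b| c^-1)%R real_normK ?num_real//.
  rewrite -![in RHS]mulrA [in RHS](mulrCA (expR _)) [in RHS](mulrCA (expR _)) -expRD.
  rewrite -![in LHS]mulrA [in LHS](mulrCA (expR _)) -expRD.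
  set E1 := expR _; set E2 := expR _.
  have -> : E1 = E2.
    rewrite /E1 /E2; congr expR.
    by field: c2; rewrite b0 gt_eqF.
  by field; rewrite !gt_eqF.
have k0 x z : (0 <= k x z)%R.
  by rewrite !mulr_ge0 ?normal_pdf_ge0// invr_ge0.
have mk2 : measurable_fun setT (fun xz : RM * RM => k xz.1 xz.2).
  apply: measurable_funM => //; apply: measurable_funM.
    by apply: measurableT_comp => //; exact: measurable_normal_pdf.
  apply: measurableT_comp; first exact: measurable_normal_pdf.
  apply: measurable_funM => //; apply: measurable_funB => //.
  exact: measurable_funM.
have mk x : measurable_fun setT (fun z : RM => k x z).
  exact: (measurableT_comp mk2 (pair1_measurable x)).
have mk' z : measurable_fun setT (fun x : RM => k x z).
  exact: (measurableT_comp mk2 (pair2_measurable z)).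
have mkf : measurable_fun setT (fun xz : RM * RM => (k xz.1 xz.2)%:E * f xz.2).
  apply: emeasurable_funM; first exact/measurable_EFinP.
  exact: measurableT_comp.
have kf0 (xz : RM * RM) : 0 <= (k xz.1 xz.2)%:E * f xz.2.
  by rewrite mule_ge0// lee_fin.
transitivity (\int[mu]_x \int[mu]_z ((k x z)%:E * f z)).
  rewrite integral_normal_prob; first last.
  - by move=> x; exact: integral_ge0.
  - apply: (measurable_fun_fubini_tonelli_F (fun p : RM * RM => f (a * p.1 + b * p.2)%R)) => //.
    apply: (measurableT_comp mf); apply: measurable_funD; exact: measurable_funM.
  apply: eq_integral => x _.
  have mfx : measurable_fun setT (fun y : RM => f (a * x + b * y)%R).
    by apply: (measurableT_comp mf); apply: measurable_funD => //; exact: measurable_funM.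
  rewrite integral_normal_prob; [|by []|by []].
  pose g (z : RM) := ((normal_pdf 0 1 ((z - a * x) / b)%R)%:E * f z).
  have mg : measurable_fun setT g.
    apply: emeasurable_funM => //; apply/measurable_EFinP.
    apply: measurableT_comp; first exact: measurable_normal_pdf.
    by apply: measurable_funM => //; exact: measurable_funB.
  have g0 z : 0 <= g z by rewrite mule_ge0// lee_fin normal_pdf_ge0.
  transitivity ((normal_pdf 0 1 x)%:E * \int[mu]_y g (b * y + a * x)%R).
    apply: (congr1 (fun I => (normal_pdf 0 1 x)%:E * I)).
    apply: eq_integral => y _; rewrite /g addrK.
    by rewrite [(b * y)%R]mulrC mulfK// addrC [(y * b)%R]mulrC.
  rewrite integral_affine; [|by []|by []|by []].
  rewrite muleA -EFinM -ge0_integralZl; first last.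
  - by rewrite lee_fin mulr_ge0 ?invr_ge0 ?normal_pdf_ge0.
  - by [].
  - by [].
  - by [].
  apply: eq_integral => z _; rewrite /g /k !muleA -!EFinM; congr (_%:E * _).
  by ring.
rewrite (fubini_tonelli (m1 := mu) (m2 := mu) (fun p : RM * RM => (k p.1 p.2)%:E * f p.2)) /=; [|by []|by []].
rewrite gauss_scale; [|by rewrite gt_eqF|by []|by []].
rewrite gtr0_norm; last by [].
apply: eq_integral => z _.
rewrite ge0_integralZr /=; first last.
- by [].
- by move=> x _; rewrite lee_fin.
- exact/measurable_EFinP.
- by [].
congr (_ * _).
under eq_integral do rewrite kE EFinM.
rewrite ge0_integralZl ?lee_fin ?normal_pdf_ge0//; first last.
- by move=> x _; rewrite lee_fin normal_pdf_ge0.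
- by apply/measurable_EFinP; exact: measurable_normal_pdf.
by rewrite integral_normal_pdf mule1.
Qed.

(** [gauss_sum2] applied coordinate by coordinate. Only the norm of [w] survives, which is the form
    of rotation invariance that the proof needs. *)
Lemma itint_gauss_linear n (w : nat -> R) (f : RM -> \bar R) :
  measurable_fun setT f -> (forall x, 0 <= f x) ->
  itint gam n (fun v => f (\sum_(j < n) v j * w j)%R) =
  \int[gam]_z f (Num.sqrt (sqn n w) * z)%R.
Proof.
elim: n f => [|n IH] f mf f0 /=.
  rewrite /sqn !big_ord0 sqrtr0; under eq_integral do rewrite mul0r.
  by rewrite gauss_cst.
transitivity (\int[gam]_x \int[gam]_z f (w n * x + Num.sqrt (sqn n w) * z)%R).
  apply: eq_integral => x _.
  have mfx : measurable_fun setT (fun z : RM => f (w n * x + z)%R).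
    by apply: (measurableT_comp mf); exact: measurable_funD.
  rewrite -(IH (fun z => f (w n * x + z)%R)); [|by []|by []].
  apply: eq_itint => v; congr f; rewrite big_ord_recr/= upd_eq addrC mulrC.
  by congr (_ + _)%R; apply: eq_bigr => j _; rewrite upd_ltn.
rewrite gauss_sum2; [|by []|by []].
rewrite sqr_sqrtr ?sqn_ge0; last by [].
apply: eq_integral => z _.
by rewrite /sqn big_ord_recr/= addrC.
Qed.

(** With t = 1 - 2 s > 0, the integrand times the standard density is t^(-1/2) times the density of
    variance 1 / t. *)
Lemma gauss_exp_sqr (s : R) : (s < 2^-1)%R ->
  \int[gam]_z (expR (s * z ^+ 2))%:E = ((Num.sqrt (1 - 2 * s))^-1)%:E.
Proof.
move=> s1; set t := (1 - 2 * s)%R.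
have t0 : (0 < t)%R by rewrite /t; lra.
have rt0 : (0 < Num.sqrt t)%R by rewrite sqrtr_gt0.
rewrite integral_normal_prob; first last.
- by move=> x; rewrite lee_fin expR_ge0.
- apply/measurable_EFinP; apply: measurableT_comp => //.
  by apply: measurable_funM => //; exact: measurable_funX.
transitivity (\int[mu]_x (((Num.sqrt t)^-1)%:E * (normal_pdf 0 (Num.sqrt t)^-1 x)%:E)).
  apply: eq_integral => x _; rewrite -!EFinM; congr (_%:E).
  rewrite normal_pdf1E normal_pdfsE ?invr_eq0 ?gt_eqF// ger0_norm ?invr_ge0 ?ltW//.
  rewrite invrK !mulrA mulVf ?gt_eqF// mul1r -(mulrA (normal_peak 1)) -expRD subr0.
  congr (_ * expR _)%R; rewrite exprVn sqr_sqrtr ?ltW// /t; field.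
  by rewrite gt_eqF.
rewrite ge0_integralZl ?lee_fin ?invr_ge0 ?sqrtr_ge0//; first last.
- by move=> x _; rewrite lee_fin normal_pdf_ge0.
- by apply/measurable_EFinP; exact: measurable_normal_pdf.
by rewrite integral_normal_pdf mule1.
Qed.

Lemma itint_gauss_exp_sqn n (s : R) : (s < 2^-1)%R ->
  itint gam n (fun v => (expR (s * sqn n v))%:E) =
  ((Num.sqrt (1 - 2 * s))^-1 ^+ n)%:E.
Proof.
move=> s1; elim: n => [|n IH] /=.
  by rewrite /sqn big_ord0 mulr0 expR0 expr0.
transitivity (\int[gam]_x
    ((expR (s * x ^+ 2))%:E * ((Num.sqrt (1 - 2 * s))^-1 ^+ n)%:E)).
  apply: eq_integral => x _; rewrite -IH -itintZ; first last.
  - move=> d Om c mc; apply/measurable_EFinP; apply: measurableT_comp => //.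
    by apply: measurable_funM => //; exact: measurable_sqn.
  - by move=> v; rewrite lee_fin expR_ge0.
  - by rewrite lee_fin expR_ge0.
  - by apply: eq_itint => v; rewrite sqn_upd mulrDr expRD -EFinM mulrC.
rewrite ge0_integralZr; first last.
- by rewrite lee_fin exprn_ge0// invr_ge0 sqrtr_ge0.
- by move=> x _; rewrite lee_fin expR_ge0.
- apply/measurable_EFinP; apply: measurableT_comp => //.
  by apply: measurable_funM => //; exact: measurable_funX.
- by [].
by rewrite gauss_exp_sqr// -EFinM exprS.
Qed.

End GaussianIntegrals.

(** * Polar coordinates for degree-0 homogeneous functions, by slicing the Gaussian into balls *)

Section PolarCoordinates.
Local Open Scope ereal_scope.
Context {R : realType}.
Local Notation RM := (measurableTypeR R).
Local Notation mu := (@lebesgue_measure R).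
Local Notation gam := (@normal_prob R 0%R 1%R).

Definition ballf (n : nat) (v : nat -> R) : \bar R :=
  if (sqn n v <= 1)%R then 1 else 0.

Lemma ballf_ge0 n v : 0 <= ballf n v.
Proof. by rewrite /ballf; case: ifP. Qed.

Lemma sqn_scale n r (v : nat -> R) : sqn n (fun j => r * v j)%R = (r ^+ 2 * sqn n v)%R.
Proof. by rewrite /sqn big_distrr/=; apply: eq_bigr => j _; rewrite exprMn. Qed.

(** The slice of the Gaussian density at height [t]. The strict bound [t < normal_peak 1 ^+ n]
    discards a single height, at which the ball would have radius 0 and could not be rescaled to the
    unit ball. *)
Let layer (n : nat) (t : R) (v : nat -> R) : \bar R :=
  if (0 < t)%R && (t < normal_peak 1 ^+ n)%R && (t <= gdens n v)%R then 1 else 0.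

Let layer_ge0 n t v : 0 <= layer n t v.
Proof. by rewrite /layer; case: ifP. Qed.

Let peak_gt0 n : (0 < normal_peak (1 : R) ^+ n)%R.
Proof. by rewrite exprn_gt0// normal_peak_gt0 ?oner_eq0. Qed.

Let integral_layer n v : \int[mu]_t layer n t v = (gdens n v)%:E.
Proof.
have g0 : (0 < gdens n v)%R by rewrite mulr_gt0 ?expR_gt0.
have gP : (gdens n v <= normal_peak 1 ^+ n)%R.
  rewrite /gdens ler_piMr ?(ltW (peak_gt0 n))// -expR0 ler_expR oppr_le0.
  by rewrite divr_ge0// sqn_ge0.
(* Off the peak the admissible heights form an interval closed at [gdens n v]; at the peak the
   discarded height makes it open. The length is the same. *)
have [gltP|gleP] := ltP (gdens n v) (normal_peak 1 ^+ n)%R.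
  transitivity (\int[mu]_t (\1_`]0%R, (gdens n v)]%classic t : R)%:E).
    apply: eq_integral => t _; rewrite /layer indicE mem_setE in_itv/=.
    have [t0|t0]/= := ltP 0%R t; last by [].
    have [tg|tg] := leP t (gdens n v); last by rewrite andbF.
    by rewrite (le_lt_trans tg gltP).
  rewrite integral_indic//= setIT lebesgue_measure_itv/= lte_fin g0.
  by rewrite oppr0 adde0.
transitivity (\int[mu]_t (\1_`]0%R, (gdens n v)[%classic t : R)%:E).
  have -> : gdens n v = (normal_peak 1 ^+ n)%R by apply/eqP; rewrite eq_le gP gleP.
  apply: eq_integral => t _; rewrite /layer indicE mem_setE in_itv/=.
  have [t0|t0]/= := ltP 0%R t; last by [].
  have [tg|tg] := ltP t (normal_peak (1 : R) ^+ n)%R; last by [].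
  by rewrite /= (le_trans (ltW tg) gleP).
rewrite integral_indic//= setIT lebesgue_measure_itv/= lte_fin g0.
by rewrite oppr0 adde0.
Qed.

(* [level n t] is the radius of the ball [{v | t <= gdens n v}]. *)
Let level (n : nat) (t : R) : R :=
  Num.sqrt (2 * (ln (normal_peak 1 ^+ n) - ln t))%R.

Let levelP n t v : (0 < t)%R -> (t < normal_peak 1 ^+ n)%R ->
  (t <= gdens n v)%R = (sqn n v <= level n t ^+ 2)%R.
Proof.
move=> t0 tP; have lt : (ln t < ln (normal_peak (1 : R) ^+ n))%R by rewrite ltr_ln ?posrE.
rewrite /level sqr_sqrtr; last by rewrite mulr_ge0// subr_ge0 ltW.
rewrite /gdens -{1}(lnK t0) -{1}(lnK (peak_gt0 n)) -expRD ler_expR.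
by apply/idP/idP => ?; lra.
Qed.

Let level_gt0 n t : (0 < t)%R -> (t < normal_peak 1 ^+ n)%R -> (0 < level n t)%R.
Proof.
move=> t0 tP; rewrite sqrtr_gt0 mulr_gt0// subr_gt0 ltr_ln ?posrE//.
Qed.

(** The volume factor from the unit ball to the ball at height [t]; its integral over [t] is the
    constant of the next lemma. *)
Let radial (n : nat) (t : R) : \bar R :=
  if (0 < t)%R && (t < normal_peak 1 ^+ n)%R then (level n t ^+ n)%:E else 0.

Let measurable_radial n : measurable_fun setT (radial n : RM -> \bar R).
Proof.
apply: measurable_fun_ifT => //.
  by apply: measurable_and; exact: measurable_fun_ltr.
apply/measurable_EFinP; apply: measurable_funX.
apply: measurableT_comp; first by apply: continuous_measurable_fun; exact: sqrt_continuous.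
by apply: measurable_funM => //; apply: measurable_funB.
Qed.

Let cmeas_layer n : jmeas (Om0 := RM) (layer n).
Proof.
move=> d Om p c mp mc; apply: measurable_fun_ifT => //.
apply: measurable_and; last by apply: measurable_fun_ler => //; exact: measurable_gdens.
by apply: measurable_and; exact: measurable_fun_ltr.
Qed.

(** The Gaussian density is a superposition of indicators of balls, and on a ball of radius r a
    degree-0 homogeneous function integrates to r^n times its integral over the unit ball. Since
    [kappa] does not depend on [psi], its value is never computed: [psi = 1] determines it. *)
Lemma itint_gauss_homogeneous n : exists kappa : \bar R, 0 <= kappa /\
  forall psi : (nat -> R) -> \bar R,
    (forall v, 0 <= psi v) -> cmeas psi ->
    (forall r v, (0 < r)%R -> psi (fun j => r * v j)%R = psi v) ->
    itint gam n psi = kappa * itint mu n (fun v => ballf n v * psi v).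
Proof.
exists (\int[mu]_t radial n t); split.
  apply: integral_ge0 => t _; rewrite /radial; case: ifP => // _.
  by rewrite lee_fin exprn_ge0// sqrtr_ge0.
move=> psi psi0 mpsi hom; rewrite itint_gauss//.
have mL : jmeas (Om0 := RM) (fun t v => layer n t v * psi v).
  move=> d Om p c mp mc; apply: emeasurable_funM; last exact: mpsi.
  exact: cmeas_layer.
transitivity (itint mu n (fun v => \int[mu]_t (layer n t v * psi v))).
  apply: eq_itint => v.
  have mlv : measurable_fun setT (fun t : RM => layer n t v).
    by have := @cmeas_layer n _ RM id (fun j _ => v j); apply.
  by rewrite ge0_integralZr ?integral_layer.
rewrite -(@itint_tonelli _ mu n _ RM mu (fun t v => layer n t v * psi v)); [|by move=> t v; rewrite mule_ge0|by []].
rewrite -ge0_integralZr; first last.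
- by apply: itint_ge0 => v; rewrite mule_ge0// ballf_ge0.
- move=> t _; rewrite /radial; case: ifP => // _.
  by rewrite lee_fin exprn_ge0// sqrtr_ge0.
- exact: measurable_radial.
- by [].
apply: eq_integral => t _; rewrite /radial.
case: ifPn => [/andP[t0 tP]|tn]; last first.
  rewrite mul0e -[RHS](itint0 mu n); apply: eq_itint => v.
  by rewrite /layer (negbTE tn) mul0e.
have l0 := level_gt0 t0 tP.
rewrite -(itint_scale n l0); first last.
- exact: (jmeas_at t mL).
- by move=> v; rewrite mule_ge0.
congr (_ * _); apply: eq_itint => v; rewrite hom//; congr (_ * _).
rewrite /layer t0 tP/= levelP// sqn_scale /ballf.
by rewrite ger_pMr// exprn_gt0.
Qed.

End PolarCoordinates.

(** * From the cone measure on the sphere to a Gaussian expectation *)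

Section SphereProbability.
Local Open Scope ereal_scope.
Context {R : realType}.
Local Notation mu := (@lebesgue_measure R).
Local Notation gam := (@normal_prob R 0%R 1%R).

(** [S] itself may be non-measurable: the indicator of its cone lies below [ballf d v * psi v], and
    monotonicity does the rest. Taking [psi = 1] gives kappa vol(ball) = 1, so the ratio of volumes
    is kappa vol(cone), at most the Gaussian mean of [psi]. *)
Lemma sphere_prob_le d (S : set 'rV[R]_d) (psi : (nat -> R) -> \bar R) (p : R) :
  (forall v, 0 <= psi v) -> cmeas psi ->
  (forall r v, (0 < r)%R -> psi (fun j => r * v j)%R = psi v) ->
  (forall v : nat -> R, sqn d v = 1%R -> S (\row_j v j) -> 1 <= psi v) ->
  itint gam d psi <= p%:E -> (sphere_prob S <= p)%R.
Proof.
move=> psi0 mpsi hom Spsi psip.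
have [kappa [k0 kE]] := @itint_gauss_homogeneous R d.
rewrite /sphere_prob /leb_vol !iter_leb_intE.
have sqE (v : nat -> R) : sqnorm (\row_(j < d) v j) = sqn d v.
  by rewrite /sqnorm /sqn; apply: eq_bigr => j _; rewrite mxE.
set W := itint _ _ _; set V1 := itint mu d _.
pose V := itint mu d (fun v => ballf d v * psi v).
have V1E : V1 = itint mu d (fun v => ballf d v * 1).
  apply: eq_itint => v; rewrite mule1 indicE /ballf.
  rewrite (_ : (_ \in _) = (sqn d v <= 1)%R); first by case: ifP.
  by apply/idP/idP; rewrite inE /unit_ball/= sqE.
have kV1 : kappa * V1 = 1.
  rewrite V1E -(kE (fun=> 1)); [exact: itint_gauss_cst|by []|by []|by []].
have kV : kappa * V <= p%:E by rewrite -kE.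
have WV : W <= V.
  apply: le_itint => v; first by rewrite lee_fin indicE.
  rewrite indicE; case: (boolP (_ \in _)) => [/set_mem|_]; last by rewrite mule_ge0 ?ballf_ge0.
  move=> [r [th [/andP[r0 r1] [[Sth sth] vE]]]].
  have thE : th = \row_j (r^-1 * v j)%R.
    apply/rowP => j; have /rowP/(_ j) := vE; rewrite !mxE => ->.
    by rewrite mulrA mulVf ?mul1r// gt_eqF.
  have q1 : sqn d (fun j => r^-1 * v j)%R = 1%R by rewrite -sqE -thE.
  have p1 : 1 <= psi v.
    rewrite -(hom r^-1%R) ?invr_gt0//; apply: Spsi => //.
    by rewrite -thE.
  rewrite /ballf ifT ?mul1e//.
  have := q1; rewrite sqn_scale => /(congr1 ( *%R (r ^+ 2))).
  rewrite mulrA exprVn divff ?mul1r ?mulr1 => [->|]; last by rewrite expf_eq0 gt_eqF.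
  by rewrite expr_le1// ltW.
have V10 : 0 <= V1 by apply: itint_ge0 => v; rewrite lee_fin indicE.
have W0 : 0 <= W by apply: itint_ge0 => v; rewrite lee_fin indicE.
have V0 : 0 <= V by apply: itint_ge0 => v; rewrite mule_ge0 ?ballf_ge0.
move: kappa V1 V W k0 {kE V1E} V0 kV1 kV WV V10 W0 => kappa V1 V W.
(* The remaining cases show that every quantity is finite, so that [fine] never returns its default
   0: [kappa * V1 = 1] settles [kappa] and [V1], then [kappa * V <= p] settles [V] and hence [W]. *)
case: kappa => [k| |]//; last first.
  move=> _ _; case: V1 => [v| |]//=.
  - have [->|v0] := eqVneq v 0%R; first by rewrite mule0 => /eqP; rewrite eqe eq_sym oner_eq0.
    by rewrite mulyr; case: (ltgtP v 0%R) v0 => // v0 _; rewrite ?(gtr0_sg v0) ?(ltr0_sg v0) ?mul1e ?mulN1e.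
rewrite lee_fin => k0 V0; case: V1 => [v| |]//=; last first.
  move: k0; rewrite le_eqVlt => /predU1P[<-|k0]; first by rewrite mul0e => /eqP; rewrite eqe eq_sym oner_eq0.
  by rewrite mulry (gtr0_sg k0) mul1e.
rewrite -EFinM => -[kv1]; case: V V0 => [V| |]// V0; last first.
  rewrite mulry; have kp : (0 < k)%R.
    rewrite lt_neqAle k0 andbT; apply: contra_eq_neq kv1 => <-.
    by rewrite mul0r eq_sym oner_eq0.
  by rewrite (gtr0_sg kp) mul1e.
rewrite -EFinM lee_fin => kV; case: W => [W| |]//=.
rewrite !lee_fin => WV v0 W0.
have vE : (v^-1 = k)%R by rewrite -[RHS](mulfK (_ : v != 0))%R ?kv1 ?mul1r//;
  apply: contra_eq_neq kv1 => ->; rewrite mulr0 eq_sym oner_eq0.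
rewrite vE (le_trans _ kV)// mulrC.
exact: ler_wpM2l.
Qed.

End SphereProbability.

(** * One-dimensional Brunn-Minkowski and Prekopa-Leindler inequalities *)

Section PrekopaLeindler.
Local Open Scope ereal_scope.
Context {R : realType}.
Local Notation RM := (measurableTypeR R).
Local Notation mu := (@lebesgue_measure R).

Let shift_measure (b : R) (A : set RM) : measurable A ->
  mu [set z | A (z - b)%R] = mu A.
Proof.
move=> mA; have := @lebesgue_measure_affine R 1 (- b) A (oner_neq0 _) mA.
rewrite normr1 invr1 mul1e => <-; congr (mu _).
by apply/seteqP; split => z /=; rewrite mul1r.
Qed.

Let half_measure (A : set RM) : measurable A ->
  mu [set z | A (z / 2)%R] = 2%:E * mu A.
Proof.
move=> mA; have h0 : (2^-1 != 0 :> R)%R by rewrite invr_eq0.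
have := @lebesgue_measure_affine R 2^-1 0 A h0 mA.
rewrite ger0_norm ?invr_ge0// invrK => <-; congr (mu _).
by apply/seteqP; split => z /=; rewrite addr0 mulrC.
Qed.

Let measurable_shift (b : R) (A : set RM) : measurable A ->
  measurable ([set z | A (z - b)%R] : set RM).
Proof.
move=> mA; have mf : measurable_fun setT (fun z : RM => (z - b)%R).
  exact: measurable_funB.
by have := mf measurableT A mA; rewrite setTI.
Qed.

(* With a = max K and b = min L, the sets K + b and a + L overlap in one
   point and both lie in 2 C. *)
Let brunn_minkowski_compact (K L : set RM) (C : set RM) :
  compact (K : set R) -> compact (L : set R) -> K !=set0 -> L !=set0 ->
  measurable C -> (forall x y, K x -> L y -> C ((x + y) / 2)%R) ->
  mu K + mu L <= 2%:E * mu C.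
Proof.
move=> cK cL K0 L0 mC KLC.
have mK : measurable K by exact: compact_measurable.
have mL : measurable L by exact: compact_measurable.
have idc (A : set R) : {within A, continuous (id : R -> R)}.
  by apply: continuous_subspaceT => x; exact: cvg_id.
have [a + amax] := compact_EVT_max K0 cK (idc K); rewrite inE => Ka.
have [b + bmin] := compact_EVT_min L0 cL (idc L); rewrite inE => Lb.
rewrite -half_measure//.
pose K' : set RM := [set z | K (z - b)%R].
pose L' : set RM := [set z | L (z - a)%R].
have mK' : measurable K' by exact: measurable_shift.
have mL' : measurable L' by exact: measurable_shift.
rewrite -(shift_measure b mK) -(shift_measure a mL) -/K' -/L'.
have mp : measurable ([set (a + b)%R] : set RM) by exact: measurable_set1.
have z0 : mu (K' `&` [set (a + b)%R]) = 0.
  apply: (@subset_measure0 _ _ _ mu _ [set (a + b)%R]) => //.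
    exact: measurableI.
  exact: lebesgue_measure_set1.
have -> : mu K' = mu (K' `\` [set (a + b)%R]).
  transitivity (mu (K' `\` [set (a + b)%R]) + mu (K' `&` [set (a + b)%R])).
    exact: measureDI.
  by rewrite z0 adde0.
have mKp : measurable (K' `\` [set (a + b)%R]) by exact: measurableD.
rewrite -measureU//.
  apply: le_measure; rewrite ?inE//.
  - exact: measurableU.
  - have mf : measurable_fun setT (fun z : RM => (z / 2)%R) by exact: measurable_funM.
    by have := mf measurableT C mC; rewrite setTI.
  - move=> z [[/= Kz _]|/= Lz].
      by have := KLC _ _ Kz Lb; rewrite subrK.
    by have := KLC _ _ Ka Lz; rewrite addrC subrK.
apply/seteqP; split => // z [[/= Kz zab] /= Lz]; apply: zab => /=.
have : (z - b <= a)%R by apply: amax; rewrite inE.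
have : (b <= z - a)%R by apply: bmin; rewrite inE.
by move=> h1 h2; apply/eqP; rewrite eq_le; apply/andP; split; lra.
Qed.

(** Inner regularity reduces to compact subsets, first of [A] for a fixed compact part of [B], then
    of [B]. The case of infinite [mu C] is trivial, and otherwise all measures are finite and may be
    subtracted. *)
Lemma brunn_minkowski (A B C : set RM) :
  measurable A -> measurable B -> measurable C -> A !=set0 -> B !=set0 ->
  (forall x y, A x -> B y -> C ((x + y) / 2)%R) ->
  mu A + mu B <= 2%:E * mu C.
Proof.
move=> mA mB mC [a Aa] [b Bb] ABC.
set X := 2%:E * mu C.
have KLX (K L : set R) : compact K -> K `<=` A -> compact L -> L `<=` B ->
    mu K + mu L <= X.
  move=> cK KA cL LB.
  (* The compact subsets may be empty, so one point of [A] and one of [B] are adjoined. *)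
  pose K' := K `|` [set a]; pose L' := L `|` [set b].
  have cK' : compact K' by apply: compactU => //; exact: compact_set1.
  have cL' : compact L' by apply: compactU => //; exact: compact_set1.
  apply: (@le_trans _ _ (mu K' + mu L')).
    by apply: leeD; apply: le_measure; rewrite ?inE//; try exact: compact_measurable;
       move=> z ?; left.
  apply: (brunn_minkowski_compact _ _ _ _ mC) => //; [by exists a; right|by exists b; right|].
  by move=> x y [Kx|->] [Ly|->]; apply: ABC => //; [exact: KA|exact: LB|exact: KA|exact: LB].
have [Xoo|Xoo] := eqVneq X +oo; first by rewrite Xoo leey.
have X0 : 0 <= X by rewrite mule_ge0.
have Xfin : X \is a fin_num by rewrite ge0_fin_numE// ltey.
have muAL (L : set R) : compact L -> L `<=` B -> mu A + mu L <= X.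
  move=> cL LB.
  have Lfin : mu L \is a fin_num.
    rewrite ge0_fin_numE//; apply: (@le_lt_trans _ _ X); last by rewrite ltey.
    have := KLX set0 L (@compact0 _) (sub0set _) cL LB.
    by rewrite measure0 add0e.
  rewrite -leeBrDr//; rewrite (lebesgue_regularity_inner_sup mA).
  apply: ge_ereal_sup => _ [K [cK KA] <-].
  by rewrite leeBrDr//; exact: KLX.
have Afin : mu A \is a fin_num.
  rewrite ge0_fin_numE//; apply: (@le_lt_trans _ _ X); last by rewrite ltey.
  have := muAL set0 (@compact0 _) (sub0set _).
  by rewrite measure0 adde0.
rewrite addeC -leeBrDr// (lebesgue_regularity_inner_sup mB).
apply: ge_ereal_sup => _ [L [cL LB] <-].
by rewrite leeBrDr// addeC; exact: muAL.
Qed.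

Let superlevel (f : RM -> R) t : set RM := [set x | t < f x]%R.

Let measurable_superlevel f t : measurable_fun setT f -> measurable (superlevel f t).
Proof.
move=> mf; rewrite (_ : superlevel f t = (fun x => t < f x)%R @^-1` [set true]).
  have : measurable_fun setT (fun x => t < f x)%R by exact: measurable_fun_ltr.
  by move=> /(_ measurableT [set true]); rewrite setTI; exact.
by apply/seteqP; split.
Qed.

Let integral_superlevel (f : RM -> R) : measurable_fun setT f ->
  (forall x, 0 <= f x)%R ->
  \int[mu]_x (f x)%:E =
  \int[mu]_t (if (0 < t)%R then mu (superlevel f t) else 0) /\
  measurable_fun setT (fun t : RM => if (0 < t)%R then mu (superlevel f t) else 0).
Proof.
move=> mf f0.
pose k (p : RM * RM) : \bar R := if (0 < p.2)%R && (p.2 < f p.1)%R then 1 else 0.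
have mk : measurable_fun setT k.
  apply: measurable_fun_ifT => //; apply: measurable_and.
    exact: measurable_fun_ltr.
  by apply: measurable_fun_ltr => //; exact: measurableT_comp.
have k0 p : 0 <= k p by rewrite /k; case: ifP.
have E t : \int[mu]_x k (x, t) = if (0 < t)%R then mu (superlevel f t) else 0.
  rewrite /k/=; case: ifP => t0; last by rewrite integral_cst// mul0e.
  transitivity (\int[mu]_x (\1_(superlevel f t) x : R)%:E).
    apply: eq_integral => x _; rewrite indicE /=.
    by rewrite (_ : (x \in _) = (t < f x)%R); [case: ifP|apply/idP/idP; rewrite inE].
  by rewrite integral_indic ?setIT//; exact: measurable_superlevel.
split; last first.
  rewrite (_ : (fun t => _) = (fun t => \int[mu]_x k (x, t))); last first.
    by apply/funext => t; rewrite E.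
  exact: (measurable_fun_fubini_tonelli_G (m1 := mu) k).
transitivity (\int[mu]_t \int[mu]_x k (x, t)); last by apply: eq_integral => t _.
rewrite -(fubini_tonelli (m1 := mu) (m2 := mu) k mk k0).
apply: eq_integral => x _; rewrite /k/=.
transitivity (\int[mu]_t (\1_`]0%R, (f x)[%classic t : R)%:E).
  rewrite integral_indic//= setIT lebesgue_measure_itv/= lte_fin.
  have := f0 x; rewrite le_eqVlt => /predU1P[<-|->]; first by rewrite ltxx.
  by rewrite oppr0 adde0.
apply: eq_integral => t _; rewrite indicE mem_setE in_itv/=.
by case: ifP.
Qed.

(** With both suprema equal to 1, the superlevel sets at height t < 1 are both nonempty, as
    Brunn-Minkowski requires, and those at t >= 1 are both empty. If f x > t and g y > t then h > t
    at the midpoint; integrating over t gives an additive inequality, from which the product form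
    follows by AM-GM. *)
Let prekopa_leindler_normalized (f g h : RM -> R) :
  measurable_fun setT f -> measurable_fun setT g -> measurable_fun setT h ->
  (forall x, 0 <= f x)%R -> (forall x, 0 <= g x)%R -> (forall x, 0 <= h x)%R ->
  (forall x, f x <= 1)%R -> (forall x, g x <= 1)%R ->
  (forall t, t < 1 -> exists x, t < f x)%R ->
  (forall t, t < 1 -> exists x, t < g x)%R ->
  (forall x y, f x * g y <= h ((x + y) / 2) ^+ 2)%R ->
  \int[mu]_x (f x)%:E + \int[mu]_x (g x)%:E <= 2%:E * \int[mu]_x (h x)%:E.
Proof.
move=> mf mg mh f0 g0 h0 f1 g1 fs gs fgh.
have [fE fm] := integral_superlevel mf f0.
have [gE gm] := integral_superlevel mg g0.
have [hE hm] := integral_superlevel mh h0.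
rewrite fE gE hE -ge0_integralD; first last.
- by [].
- by move=> t _; case: ifP.
- by [].
- by move=> t _; case: ifP.
- by [].
rewrite -ge0_integralZl; first last.
- by rewrite lee_fin.
- by move=> t _; case: ifP.
- by [].
- by [].
apply: ge0_le_int => t; first by case: ifP => _; rewrite ?adde0// adde_ge0.
case: ifP => t0; last by rewrite adde0 mule0.
have [t1|t1] := ltP t 1%R; last first.
  rewrite (_ : superlevel f t = set0); last first.
    by apply/seteqP; split => // x; rewrite /superlevel/= ltNge (le_trans (f1 x) t1).
  rewrite (_ : superlevel g t = set0); last first.
    by apply/seteqP; split => // x; rewrite /superlevel/= ltNge (le_trans (g1 x) t1).
  by rewrite measure0 adde0 mule_ge0.
apply: brunn_minkowski; try exact: measurable_superlevel.
- by have [x ?] := fs t t1; exists x.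
- by have [x ?] := gs t t1; exists x.
move=> x y /= tf tg; have := fgh x y; set H := h _ => fgH.
have : (t ^+ 2 < H ^+ 2)%R.
  by apply: lt_le_trans fgH; rewrite expr2 ltr_pM// ltW.
by rewrite ltr_pXn2r// nnegrE; [exact: ltW|exact: h0].
Qed.

Let amgm_ereal (F G H : \bar R) : 0 <= F -> 0 <= G -> 0 <= H ->
  F + G <= 2%:E * H -> F * G <= H * H.
Proof.
case: H => [H| |]; [|by move=> *; rewrite mulyy leey|by []].
case: F => [F| |]; case: G => [G| |] //.
rewrite !lee_fin => F0 G0 H0 FGH.
have : (0 <= (F - G) ^+ 2)%R by exact: sqr_ge0.
have : ((F + G) ^+ 2 <= (2 * H) ^+ 2)%R by rewrite lerXn2r// nnegrE; lra.
rewrite !expr2; nra.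
Qed.

(** The bound [C] makes the suprema Mf and Mg finite. Dividing f by Mf, g by Mg and h by sqrt (Mf
    Mg) preserves the hypothesis and normalizes the functions; a zero supremum makes the left side
    0. *)
Lemma prekopa_leindler (f g h : RM -> R) (C : R) :
  measurable_fun setT f -> measurable_fun setT g -> measurable_fun setT h ->
  (forall x, 0 <= f x)%R -> (forall x, 0 <= g x)%R -> (forall x, 0 <= h x)%R ->
  (forall x, f x <= C)%R -> (forall x, g x <= C)%R ->
  (forall x y, f x * g y <= h ((x + y) / 2) ^+ 2)%R ->
  (\int[mu]_x (f x)%:E) * (\int[mu]_x (g x)%:E) <=
  (\int[mu]_x (h x)%:E) * (\int[mu]_x (h x)%:E).
Proof.
move=> mf mg mh f0 g0 h0 fC gC fgh.
have int0 (u : RM -> R) : (forall x, 0 <= u x)%R -> 0 <= \int[mu]_x (u x)%:E.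
  by move=> u0; apply: integral_ge0 => x _; rewrite lee_fin.
have supP (u : RM -> R) : (forall x, 0 <= u x)%R -> (forall x, u x <= C)%R ->
    (forall x, u x = 0)%R \/ exists M : R, [/\ (0 < M)%R, (forall x, u x / M <= 1)%R &
      (forall t, t < 1 -> exists x, t < u x / M)%R].
  move=> u0 uC; pose E := range u.
  have hsE : has_sup E by split; [exists (u 0%R), 0%R|exists C => _ [x _ <-]].
  have uM x : (u x <= sup E)%R by apply: sup_upper_bound => //; exists x.
  have [M0|M0] := leP (sup E) 0%R.
    by left => x; apply/eqP; rewrite eq_le u0 (le_trans (uM x)).
  right; exists (sup E); split => //.
    by move=> x; rewrite ler_pdivrMr// mul1r.
  move=> t t1; have tM : (t * sup E < sup E)%R by rewrite gtr_pMl.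
  have [_ [x _ <-] tx] := sup_gt hsE.1 tM.
  by exists x; rewrite ltr_pdivlMr.
have [fz|[Mf [Mf0 f1 fs]]] := supP f f0 fC.
  under eq_integral do rewrite fz.
  by rewrite integral0 mul0e mule_ge0// int0.
have [gz|[Mg [Mg0 g1 gs]]] := supP g g0 gC.
  under [X in _ * X <= _]eq_integral do rewrite gz.
  by rewrite integral0 mule0 mule_ge0// int0.
pose s := Num.sqrt (Mf * Mg).
have s0 : (0 < s)%R by rewrite sqrtr_gt0 mulr_gt0.
have s2 : (s * s = Mf * Mg)%R by rewrite -expr2 sqr_sqrtr// mulr_ge0// ltW.
have intZ (u : RM -> R) (M : R) : measurable_fun setT u -> (forall x, 0 <= u x)%R -> (0 < M)%R ->
    \int[mu]_x (u x)%:E = M%:E * \int[mu]_x (u x / M)%:E.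
  move=> mu_ u0 M0; rewrite -ge0_integralZl; first last.
  - by rewrite lee_fin ltW.
  - by move=> x _; rewrite lee_fin divr_ge0// ltW.
  - by apply/measurable_EFinP; exact: measurable_funM.
  - by [].
  by apply: eq_integral => x _; rewrite -EFinM mulrCA divff ?mulr1// gt_eqF.
rewrite (intZ f Mf)// (intZ g Mg)// (intZ h s)// !muleA.
rewrite -[_ * Mg%:E]muleA [_ * Mg%:E]muleC -[_ * s%:E]muleA [_ * s%:E]muleC.
rewrite !muleA -!EFinM s2 -!muleA; apply: lee_wpmul2l.
  by rewrite lee_fin mulr_ge0// ltW.
have dge0 (u : RM -> R) M : (forall x, 0 <= u x)%R -> (0 < M)%R -> forall x, (0 <= u x / M)%R.
  by move=> u0 M0 x; rewrite divr_ge0// ltW.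
apply: amgm_ereal; try (apply: int0; exact: dge0).
apply: prekopa_leindler_normalized => //; try exact: measurable_funM; try exact: dge0.
move=> x y; rewrite mulrACA -invfM exprMn exprVn -s2 -expr2.
by rewrite ler_wpM2r// invr_ge0 sqr_ge0.
Qed.

End PrekopaLeindler.

(** * Concentration of Lipschitz functions of a Gaussian vector *)

Section GaussianConcentration.
Local Open Scope ereal_scope.
Context {R : realType}.
Local Notation RM := (measurableTypeR R).
Local Notation mu := (@lebesgue_measure R).
Local Notation gam := (@normal_prob R 0%R 1%R).

(** The parallelogram law; it is the origin of the factor 1/4 in the exponents below. *)
Let gauss_mid (x y : R) :
  (expR ((x - y) ^+ 2 / 4) * (normal_pdf 0 1 x * normal_pdf 0 1 y) =
   normal_pdf 0 1 ((x + y) / 2) ^+ 2)%R.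
Proof.
rewrite !normal_pdf1E exprMn -expRM_natl.
transitivity (normal_peak 1 ^+ 2 * (expR ((x - y) ^+ 2 / 4) *
  (expR (- (x ^+ 2 / 2)) * expR (- (y ^+ 2 / 2)))))%R; first by ring.
by rewrite -!expRD; congr (_ * expR _)%R; field.
Qed.

(** Prekopa-Leindler for A phi, B phi and sqrt K phi, with phi the Gaussian density: by [gauss_mid]
    the factor exp ((x - y)^2 / 4) is exactly what the midpoint of the densities compensates. *)
Let gauss_tau1 (A B : RM -> \bar R) (C K : R) :
  measurable_fun setT A -> measurable_fun setT B ->
  (forall x, 0 <= A x) -> (forall x, 0 <= B x) ->
  (forall x, A x <= C%:E) -> (forall x, B x <= C%:E) ->
  (forall x y, A x * B y <= (K * expR ((x - y) ^+ 2 / 4))%:E) ->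
  (\int[gam]_x A x) * (\int[gam]_x B x) <= K%:E.
Proof.
move=> mA mB A0 B0 AC BC AB.
have Afin x : A x \is a fin_num by rewrite ge0_fin_numE// (le_lt_trans (AC x))// ltry.
have Bfin x : B x \is a fin_num by rewrite ge0_fin_numE// (le_lt_trans (BC x))// ltry.
have K0 : (0 <= K)%R.
  have := AB 0%R 0%R; rewrite subrr expr0n/= mul0r expR0 mulr1 -lee_fin.
  by apply: le_trans; rewrite mule_ge0.
have C0 : (0 <= C)%R by rewrite -lee_fin (le_trans (A0 0%R)).
pose phi := @normal_pdf R 0 1.
have phi0 x : (0 <= phi x)%R by exact: normal_pdf_ge0.
have mphi : measurable_fun setT (phi : RM -> R) by exact: measurable_normal_pdf.
pose f (x : RM) := (fine (A x) * phi x)%R.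
pose g (x : RM) := (fine (B x) * phi x)%R.
pose h (x : RM) := (Num.sqrt K * phi x)%R.
have fA0 x : (0 <= fine (A x))%R by exact: fine_ge0.
have fB0 x : (0 <= fine (B x))%R by exact: fine_ge0.
have fAC x : (fine (A x) <= C)%R by rewrite -lee_fin fineK.
have fBC x : (fine (B x) <= C)%R by rewrite -lee_fin fineK.
have intE (D : RM -> \bar R) : measurable_fun setT D -> (forall x, 0 <= D x) ->
    (forall x, D x \is a fin_num) ->
    \int[gam]_x D x = \int[mu]_x (fine (D x) * phi x)%:E.
  move=> mD D0 Dfin; rewrite integral_normal_prob; [|by []|by []].
  by apply: eq_integral => x _; rewrite EFinM fineK// muleC.
have hE : \int[mu]_x (h x)%:E = (Num.sqrt K)%:E.
  under eq_integral do rewrite EFinM.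
  rewrite ge0_integralZl; first last.
  - by rewrite lee_fin sqrtr_ge0.
  - by move=> x _; rewrite lee_fin.
  - exact/measurable_EFinP.
  - by [].
  by rewrite integral_normal_pdf mule1.
have -> : K%:E = (\int[mu]_x (h x)%:E) * (\int[mu]_x (h x)%:E).
  by rewrite hE -EFinM -expr2 sqr_sqrtr.
rewrite !intE//.
have mfine (D : RM -> \bar R) : measurable_fun setT D ->
    measurable_fun setT (fun x => (fine (D x) * phi x)%R).
  by move=> mD; apply: measurable_funM => //; exact: measurableT_comp.
apply: (@prekopa_leindler R f g h (C * normal_peak 1)).
- exact: mfine.
- exact: mfine.
- exact: measurable_funM.
- by move=> x; rewrite mulr_ge0.
- by move=> x; rewrite mulr_ge0.
- by move=> x; rewrite mulr_ge0 ?sqrtr_ge0.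
- by move=> x; rewrite ler_pM// normal_pdf_ub// oner_neq0.
- by move=> x; rewrite ler_pM// normal_pdf_ub// oner_neq0.
move=> x y; rewrite /f /g /h exprMn sqr_sqrtr// -gauss_mid mulrACA [leRHS]mulrA.
rewrite ler_wpM2r ?mulr_ge0//.
by rewrite -lee_fin EFinM !fineK.
Qed.

(** For fixed last coordinates x and y the induction hypothesis applies with K exp ((x - y)^2 / 4)
    in place of K, and the resulting bound is precisely the hypothesis of [gauss_tau1] in x and
    y. *)
Lemma gauss_tau n (a b : (nat -> R) -> \bar R) (C K : R) :
  cmeas a -> cmeas b -> (forall v, 0 <= a v) -> (forall v, 0 <= b v) ->
  (forall v, a v <= C%:E) -> (forall v, b v <= C%:E) ->
  (forall u v, a u * b v <= (K * expR (sqn n (fun j => u j - v j)%R / 4))%:E) ->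
  itint gam n a * itint gam n b <= K%:E.
Proof.
elim: n a b K => [|n IH] a b K ma mb a0 b0 aC bC ab /=.
  have := ab (fun=> 0%R) (fun=> 0%R); rewrite /sqn big_ord0 mul0r expR0.
  by rewrite mulr1.
apply: (@gauss_tau1 _ _ C) => [||x|x|x|x|x y].
- by apply: measurable_itint => //; exact: cmeas_upd.
- by apply: measurable_itint => //; exact: cmeas_upd.
- exact: itint_ge0.
- exact: itint_ge0.
- by rewrite -(itint_gauss_cst n C%:E); apply: le_itint.
- by rewrite -(itint_gauss_cst n C%:E); apply: le_itint.
apply: IH => //; try exact: cmeas_updx.
move=> u v; apply: (le_trans (ab _ _)); rewrite lee_fin.
rewrite [X in sqn _ X](_ : _ = upd n (x - y) (fun j => u j - v j)%R); last first.
  by apply/funext => j; rewrite /upd; case: eqP.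
by rewrite sqn_upd mulrDl expRD; rewrite -[leRHS]mulrA [(_ * expR (sqn _ _ / _))%R]mulrC.
Qed.

Lemma cmeas_expR (F : (nat -> R) -> R) (t : R) : cmeas (EFin \o F) ->
  cmeas (fun v => (expR (t * F v))%:E).
Proof.
move=> mF d Om c mc; apply/measurable_EFinP; apply: measurableT_comp => //.
by apply: measurable_funM => //; exact/measurable_EFinP/mF.
Qed.

(** Jensen's inequality through the tangent to exp (- t F) at F = m. *)
Let jensen_expN n (F : (nat -> R) -> R) (m t : R) :
  cmeas (EFin \o F) -> (forall v, 0 <= F v)%R ->
  itint gam n (EFin \o F) = m%:E -> (0 <= t)%R ->
  (expR (- (t * m)))%:E <= itint gam n (fun v => (expR (- t * F v))%:E).
Proof.
move=> mF F0 mE t0.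
have m0 : (0 <= m)%R.
  by rewrite -lee_fin -mE; apply: itint_ge0 => v; rewrite lee_fin.
pose e := expR (- (t * m)); have e0 : (0 < e)%R by exact: expR_gt0.
have et0 : (0 <= e * t)%R by rewrite mulr_ge0// ltW.
(* The tangent inequality with the negative term moved to the right, since [itint] is handled on
   nonnegative functions only. *)
have ineq v : ((e + e * t * m)%:E <= (expR (- t * F v))%:E + (e * t)%:E * (F v)%:E)%E.
  rewrite -EFinM -EFinD lee_fin.
  have -> : expR (- t * F v) = (e * expR (t * (m - F v)))%R.
    by rewrite -expRD; congr expR; ring.
  have /(ler_wpM2l (ltW e0)) := expR_ge1Dx (t * (m - F v))%R.
  by set X := (e * expR _)%R; nra.
have mFt : cmeas (fun v => (e * t)%:E * (F v)%:E).
  by move=> d Om c mc; apply: emeasurable_funM => //; exact: mF.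
have := @le_itint R gam n (fun=> (e + e * t * m)%:E) _ _ ineq.
rewrite itint_gauss_cst itintD; first last.
- by [].
- exact: cmeas_expR.
- by move=> v; rewrite -EFinM lee_fin mulr_ge0.
- by move=> v; rewrite lee_fin expR_ge0.
rewrite itintZ; first last.
- exact: mF.
- by move=> v; rewrite lee_fin.
- by rewrite lee_fin.
rewrite mE -EFinM EFinD leeD2rE//; apply => _.
by rewrite lee_fin addr_ge0 ?mulr_ge0// ltW.
Qed.

(** [gauss_tau] for exp (t F) and exp (- t F) bounds the product of their means by exp (t^2 L^2),
    because t L r <= t^2 L^2 + r^2 / 4 with r = |u - v|. Jensen bounds the second mean below by exp
    (- t m), and Markov's inequality concludes. *)
Let gauss_upper_tail n (F : (nat -> R) -> R) (L M m eta : R) :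
  cmeas (EFin \o F) -> (forall v, 0 <= F v)%R -> (forall v, F v <= M)%R ->
  (forall u v, F u - F v <= L * Num.sqrt (sqn n (fun j => u j - v j)))%R ->
  itint gam n (EFin \o F) = m%:E -> (0 < L)%R -> (0 < eta)%R ->
  itint gam n (fun v => if (m + eta < F v)%R then 1 else 0) <=
  (expR (- (eta ^+ 2 / (4 * L ^+ 2))))%:E.
Proof.
move=> mF F0 FM FL mE L0 e0.
(* The minimizer of t^2 L^2 - t eta. *)
pose t := (eta / (2 * L ^+ 2))%R.
have L20 : (0 < L ^+ 2)%R by rewrite exprn_gt0.
have t0 : (0 <= t)%R by rewrite divr_ge0 ?mulr_ge0 ?ltW.
have M0 : (0 <= M)%R by rewrite (le_trans (F0 (fun=> 0%R))).
pose P := itint gam n (fun v => if (m + eta < F v)%R then 1 else 0).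
have P0 : 0 <= P by apply: itint_ge0 => v; case: ifP.
have mind : cmeas (fun v => if (m + eta < F v)%R then 1 else 0 : \bar R).
  move=> d Om c mc; apply: measurable_fun_ifT => //.
  by apply: measurable_fun_ltr => //; exact/measurable_EFinP/mF.
have tau : itint gam n (fun v => (expR (t * F v))%:E) *
           itint gam n (fun v => (expR (- t * F v))%:E) <= (expR (t ^+ 2 * L ^+ 2))%:E.
  apply: (@gauss_tau n _ _ (expR (t * M))).
  - exact: cmeas_expR.
  - exact: cmeas_expR.
  - by move=> v; rewrite lee_fin expR_ge0.
  - by move=> v; rewrite lee_fin expR_ge0.
  - by move=> v; rewrite lee_fin ler_expR ler_wpM2l.
  - move=> v; rewrite lee_fin ler_expR mulNr (@le_trans _ _ 0%R)//.
      by rewrite oppr_le0 mulr_ge0.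
    by rewrite mulr_ge0.
  move=> u v; rewrite -EFinM lee_fin -!expRD ler_expR.
  have := FL u v; set r := Num.sqrt _ => Fr.
  have -> : sqn n (fun j => u j - v j)%R = (r ^+ 2)%R by rewrite sqr_sqrtr// sqn_ge0.
  have tFr : (t * (F u - F v) <= t * (L * r))%R by rewrite ler_wpM2l.
  have := sqr_ge0 (t * L - r / 2)%R; nra.
have PE : (expR (t * (m + eta)))%:E * P <= itint gam n (fun v => (expR (t * F v))%:E).
  rewrite -itintZ; first last.
  - exact: mind.
  - by move=> v; case: ifP.
  - by rewrite lee_fin expR_ge0.
  apply: le_itint => v; first by case: ifP => _; rewrite ?mule1 ?mule0// lee_fin expR_ge0.
  case: ifP => Fv; last by rewrite mule0 lee_fin expR_ge0.
  by rewrite mule1 lee_fin ler_expR ler_wpM2l// ltW.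
have JE := jensen_expN mF F0 mE t0.
have ub : (expR (t * eta))%:E * P <= (expR (t ^+ 2 * L ^+ 2))%:E.
  apply: le_trans tau.
  apply: (@le_trans _ _ ((expR (t * (m + eta)))%:E * P * (expR (- (t * m)))%:E)).
    rewrite muleAC -EFinM -expRD; rewrite le_eqVlt; apply/orP; left; apply/eqP.
    by congr ((expR _)%:E * _); ring.
  apply: lee_pmul; [| |exact: PE|exact: JE].
    by rewrite mule_ge0// lee_fin expR_ge0.
  by rewrite lee_fin expR_ge0.
have -> : (expR (- (eta ^+ 2 / (4 * L ^+ 2))))%:E =
    (expR (- (t * eta)))%:E * (expR (t ^+ 2 * L ^+ 2))%:E.
  rewrite -EFinM -expRD; congr (expR _)%:E; rewrite /t; field.
  by rewrite gt_eqF.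
rewrite -/P; have {1}-> : P = (expR (- (t * eta)))%:E * ((expR (t * eta))%:E * P).
  by rewrite muleA -EFinM -expRD addNr expR0 mul1e.
by apply: lee_wpmul2l => //; rewrite lee_fin expR_ge0.
Qed.

Lemma gauss_concentration n (F : (nat -> R) -> R) (L M m eta : R) :
  cmeas (EFin \o F) -> (forall v, 0 <= F v)%R -> (forall v, F v <= M)%R ->
  (forall u v, F u - F v <= L * Num.sqrt (sqn n (fun j => u j - v j)))%R ->
  itint gam n (EFin \o F) = m%:E -> (0 < L)%R -> (0 < eta)%R ->
  itint gam n (fun v => if (eta < `|F v - m|)%R then 1 else 0) <=
  (2 * expR (- (eta ^+ 2 / (4 * L ^+ 2))))%:E.
Proof.
move=> mF F0 FM FL mE L0 e0.
have mrF d (Om : measurableType d) (c : nat -> Om -> R) :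
    (forall j, measurable_fun setT (c j)) ->
    measurable_fun setT (fun w => F (fun j => c j w)).
  by move=> mc; exact/measurable_EFinP/mF.
(* The lower tail of [F] is the upper tail of M - F, which unlike - F is nonnegative. *)
pose F' v := (M - F v)%R.
have mF' : cmeas (EFin \o F').
  by move=> d Om c mc; apply/measurable_EFinP; apply: measurable_funB => //; exact: mrF.
have F'0 v : (0 <= F' v)%R by rewrite subr_ge0.
have mE' : itint gam n (EFin \o F') = (M - m)%:E.
  have : itint gam n (EFin \o F') + itint gam n (EFin \o F) = M%:E.
    rewrite -itintD; first last.
    - exact: mF.
    - exact: mF'.
    - by move=> v; rewrite lee_fin.
    - by move=> v; rewrite lee_fin.
    rewrite -[RHS](itint_gauss_cst n); apply: eq_itint => v.
    by rewrite /= -EFinD /F' subrK.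
  by rewrite mE EFinB => <-; rewrite addeK.
have up := gauss_upper_tail mF F0 FM FL mE L0 e0.
have lo : itint gam n (fun v => if (M - m + eta < F' v)%R then 1 else 0) <=
    (expR (- (eta ^+ 2 / (4 * L ^+ 2))))%:E.
  apply: (@gauss_upper_tail n F' L M) => //.
  - by move=> v; rewrite gerBl.
  - move=> u v; have := FL v u.
    rewrite (_ : sqn n (fun j => v j - u j)%R = sqn n (fun j => u j - v j)%R).
      by rewrite /F'; lra.
    by apply: eq_bigr => j _; rewrite -sqrrN opprB.
rewrite mulr2n mulrDl mul1r EFinD; apply: (le_trans _ (leeD up lo)).
rewrite -itintD.
- apply: le_itint => v; first by case: ifP.
  case: ifP => [|_]; last by rewrite adde_ge0//; case: ifP.
  rewrite lter_normr => /orP[h|h].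
    rewrite (_ : (m + eta < F v)%R = true); last by lra.
    by rewrite leeDl//; case: ifP.
  rewrite (_ : (M - m + eta < F' v)%R = true); last by rewrite /F'; lra.
  by rewrite leeDr//; case: ifP.
- by move=> v; case: ifP.
- by move=> v; case: ifP.
- move=> d Om c mc; apply: measurable_fun_ifT => //.
  by apply: measurable_fun_ltr => //; exact: mrF.
- move=> d Om c mc; apply: measurable_fun_ifT => //.
  apply: measurable_fun_ltr => //; apply: measurable_funB => //; exact: mrF.
Qed.

End GaussianConcentration.

(** * Chernoff bound for the norm of a Gaussian vector *)

Section GaussianNorm.
Local Open Scope ereal_scope.
Context {R : realType}.
Local Notation gam := (@normal_prob R 0%R 1%R).

(** After squaring: (1 + u + 2 u^2)(1 - u) = 1 + u^2 (1 - 2 u) >= 1, and 1 + y <= exp y. *)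
Let inv_sqrt_le (u : R) : (`|u| <= 2^-1)%R ->
  ((Num.sqrt (1 - u))^-1 <= expR (u / 2 + u ^+ 2))%R.
Proof.
rewrite ler_norml => /andP[u1 u2].
have u0 : (0 < 1 - u)%R by lra.
have s0 : (0 < Num.sqrt (1 - u))%R by rewrite sqrtr_gt0.
rewrite -(@ler_pXn2r _ 2) ?nnegrE ?invr_ge0 ?expR_ge0 ?(ltW s0)//.
rewrite exprVn (sqr_sqrtr (ltW u0)) -expRM_natl.
rewrite -(ler_pM2r u0) mulVf ?gt_eqF//.
apply: (@le_trans _ _ ((1 + (u + 2 * u ^+ 2)) * (1 - u))%R); first nra.
rewrite ler_wpM2r ?(ltW u0)//.
have -> : (2%:R * (u / 2 + u ^+ 2) = u + 2 * u ^+ 2)%R by field.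
exact: expR_ge1Dx.
Qed.

(** The sign of [u] selects the tail: the event is |v|^2 >= c for u > 0 and |v|^2 <= c for u < 0. *)
Let chernoff_sqn n (u c : R) : (`|u| <= 2^-1)%R ->
  itint gam n (fun v => if (u * c <= u * sqn n v)%R then 1 else 0) <=
  (expR (n%:R * (u / 2 + u ^+ 2) - u / 2 * c))%:E.
Proof.
move=> u1; have u2 : (u / 2 < 2^-1)%R.
  by move: u1; rewrite ler_norml; lra.
have -> : (expR (n%:R * (u / 2 + u ^+ 2) - u / 2 * c))%:E =
    (expR (- (u / 2 * c)))%:E * (expR (n%:R * (u / 2 + u ^+ 2)))%:E.
  by rewrite -EFinM -expRD addrC.
apply: (@le_trans _ _ ((expR (- (u / 2 * c)))%:E *
    itint gam n (fun v => (expR (u / 2 * sqn n v))%:E))).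
  rewrite -itintZ; first last.
  - move=> d Om k mk; apply/measurable_EFinP; apply: measurableT_comp => //.
    by apply: measurable_funM => //; exact: measurable_sqn.
  - by move=> v; rewrite lee_fin expR_ge0.
  - by rewrite lee_fin expR_ge0.
  apply: le_itint => v; first by case: ifP.
  rewrite -EFinM -expRD; case: ifP => h; last by rewrite lee_fin expR_ge0.
  by rewrite lee_fin -[leLHS]expR0 ler_expR; lra.
apply: lee_wpmul2l; first by rewrite lee_fin expR_ge0.
rewrite itint_gauss_exp_sqn// lee_fin expRM_natl lerXn2r// ?nnegrE ?expR_ge0 ?invr_ge0 ?sqrtr_ge0//.
have -> : (2 * (u / 2) = u)%R by field.
exact: inv_sqrt_le.
Qed.

Lemma gauss_norm_tail n (delta : R) : (0 < delta)%R -> (delta <= 2^-1)%R ->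
  itint gam n (fun v =>
    if (delta * Num.sqrt n%:R < `|Num.sqrt (sqn n v) - Num.sqrt n%:R|)%R then 1 else 0) <=
  (2 * expR (- (n%:R * delta ^+ 2 / 8)))%:E.
Proof.
move=> d0 d1; set s := Num.sqrt n%:R.
have s0 : (0 <= s)%R by exact: sqrtr_ge0.
have s2 : (s ^+ 2 = n%:R)%R by rewrite sqr_sqrtr.
have n0 : (0 <= n%:R :> R)%R by [].
have ud : (`|delta / 2| <= 2^-1)%R by rewrite ger0_norm; lra.
have nud : (`|- (delta / 2)| <= 2^-1)%R by rewrite normrN.
(* With u = delta / 2 and u = - delta / 2 the exponents are - n (delta^2 + delta^3) / 4 and - n
   (delta^2 - delta^3) / 4; delta <= 1/2 brings both below - n delta^2 / 8. *)
have up := chernoff_sqn n ((1 + delta) ^+ 2 * n%:R)%R ud.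
have lo := chernoff_sqn n ((1 - delta) ^+ 2 * n%:R)%R nud.
have d3 : (delta ^+ 3 <= delta ^+ 2 / 2)%R.
  rewrite exprS mulrC ler_pM2l ?exprn_gt0//; lra.
have d30 : (0 <= delta ^+ 3)%R by rewrite exprn_ge0// ltW.
have upb : (expR (n%:R * (delta / 2 / 2 + (delta / 2) ^+ 2) - delta / 2 / 2 * ((1 + delta) ^+ 2 * n%:R)))%:E
    <= (expR (- (n%:R * delta ^+ 2 / 8)))%:E.
  rewrite lee_fin ler_expR.
  rewrite (_ : _ - _ = n%:R * (- (delta ^+ 2 / 4) - delta ^+ 3 / 4))%R; last by field.
  rewrite (_ : - (n%:R * delta ^+ 2 / 8) = n%:R * - (delta ^+ 2 / 8))%R; last by ring.
  rewrite ler_wpM2l//.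
  have := sqr_ge0 delta; lra.
have lob : (expR (n%:R * (- (delta / 2) / 2 + (- (delta / 2)) ^+ 2) - - (delta / 2) / 2 * ((1 - delta) ^+ 2 * n%:R)))%:E
    <= (expR (- (n%:R * delta ^+ 2 / 8)))%:E.
  rewrite lee_fin ler_expR.
  rewrite (_ : _ - _ = n%:R * (- (delta ^+ 2 / 4) + delta ^+ 3 / 4))%R; last by field.
  rewrite (_ : - (n%:R * delta ^+ 2 / 8) = n%:R * - (delta ^+ 2 / 8))%R; last by ring.
  by rewrite ler_wpM2l//; lra.
rewrite mulr2n mulrDl mul1r EFinD.
apply: (le_trans _ (leeD (le_trans up upb) (le_trans lo lob))).
have mi (u c : R) : cmeas (fun v => if (u * c <= u * sqn n v)%R then 1 else 0 : \bar R).
  move=> d Om k mk; apply: measurable_fun_ifT => //.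
  apply: measurable_fun_ler => //; apply: measurable_funM => //.
  exact: measurable_sqn.
rewrite -itintD; [|by move=> v; case: ifP|by move=> v; case: ifP|exact: mi|exact: mi].
apply: le_itint => v; first by case: ifP.
case: ifP => [|_]; last by rewrite adde_ge0//; case: ifP.
have q0 : (0 <= Num.sqrt (sqn n v))%R by exact: sqrtr_ge0.
have q2 : (sqn n v = Num.sqrt (sqn n v) ^+ 2)%R by rewrite sqr_sqrtr// sqn_ge0.
rewrite lter_normr => /orP[h|h].
  rewrite (_ : (_ <= delta / 2 * sqn n v)%R = true).
    by rewrite leeDl//; case: ifP.
  apply/idP; rewrite ler_pM2l ?divr_gt0// -s2 -exprMn q2 lerXn2r// ?nnegrE//; first by rewrite mulr_ge0//; lra.
  by rewrite mulrDl mul1r; lra.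
rewrite (_ : (_ <= - (delta / 2) * sqn n v)%R = true).
  by rewrite leeDr//; case: ifP.
apply/idP; rewrite ler_nM2l ?oppr_lt0 ?divr_gt0// -s2 -exprMn q2 lerXn2r// ?nnegrE//; first by rewrite mulr_ge0//; lra.
by rewrite mulrBl mul1r; lra.
Qed.

End GaussianNorm.

(** * Linearity and monotonicity of the expectation on bounded measurable functions *)

Section BoundedExpectation.
Context {R : realType}.
Local Notation RM := (measurableTypeR R).
Variable P : probability RM R.

Definition bounded_measurable (u : RM -> R) :=
  measurable_fun setT u /\ exists C : R, forall x, `|u x| <= C.

Lemma bounded_measurable_integrable u : bounded_measurable u ->
  P.-integrable setT (EFin \o u).
Proof.
move=> [mu_ [C uC]]; apply: measurable_bounded_integrable => //.
  by rewrite [X in (X < _)%E]probability_setT ltry.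
by exists C; split; [exact: num_real|move=> x Cx y _; exact: le_trans (uC y) (ltW Cx)].
Qed.

Lemma bounded_measurable_cst k : bounded_measurable (fun=> k).
Proof. by split => //; exists `|k|. Qed.

Lemma bounded_measurableD u v : bounded_measurable u -> bounded_measurable v ->
  bounded_measurable (fun x => u x + v x).
Proof.
move=> [mu_ [C uC]] [mv [D vD]]; split; first exact: measurable_funD.
by exists (C + D) => x; rewrite (le_trans (ler_normD _ _))// lerD.
Qed.

Lemma bounded_measurableZ k u : bounded_measurable u ->
  bounded_measurable (fun x => k * u x).
Proof.
move=> [mu_ [C uC]]; split; first exact: measurable_funM.
by exists (`|k| * C) => x; rewrite normrM ler_wpM2l.
Qed.

Lemma bounded_measurableB u v : bounded_measurable u -> bounded_measurable v ->
  bounded_measurable (fun x => u x - v x).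
Proof.
move=> [mu_ [C uC]] [mv [D vD]]; split; first exact: measurable_funB.
by exists (C + D) => x; rewrite (le_trans (ler_normB _ _))// lerD.
Qed.

Lemma bounded_measurable_sum N (c : nat -> R) (r : nat -> RM -> R) :
  (forall k, bounded_measurable (r k)) ->
  bounded_measurable (fun x => \sum_(k < N) c k * r k x).
Proof.
move=> br; elim: N => [|N IH].
  rewrite (_ : (fun _ => _) = fun=> 0); first exact: bounded_measurable_cst.
  by apply/funext => x; rewrite big_ord0.
rewrite (_ : (fun _ => _) = fun x => \sum_(k < N) c k * r k x + c N * r N x).
  by apply: bounded_measurableD => //; exact: bounded_measurableZ.
by apply/funext => x; rewrite big_ord_recr.
Qed.

Lemma expect_cst (k : R) : \int[P]_x (fun=> k) x = k.
Proof.
rewrite Rintegral_cst//.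
have -> : fine (P setT) = 1 by rewrite [P setT]probability_setT.
by rewrite mulr1.
Qed.

Lemma expectD u v : bounded_measurable u -> bounded_measurable v ->
  \int[P]_x (u x + v x) = \int[P]_x u x + \int[P]_x v x.
Proof. by move=> bu bv; rewrite RintegralD//; exact: bounded_measurable_integrable. Qed.

Lemma expectB u v : bounded_measurable u -> bounded_measurable v ->
  \int[P]_x (u x - v x) = \int[P]_x u x - \int[P]_x v x.
Proof. by move=> bu bv; rewrite RintegralB//; exact: bounded_measurable_integrable. Qed.

Lemma expectZ k u : bounded_measurable u ->
  \int[P]_x (k * u x) = k * \int[P]_x u x.
Proof. by move=> bu; rewrite RintegralZl//; exact: bounded_measurable_integrable. Qed.

Lemma expect_sum N (c : nat -> R) (r : nat -> RM -> R) :
  (forall k, bounded_measurable (r k)) ->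
  \int[P]_x (\sum_(k < N) c k * r k x) = \sum_(k < N) c k * \int[P]_x r k x.
Proof.
move=> br; elim: N => [|N IH].
  rewrite big_ord0 -[RHS](expect_cst 0); apply: eq_Rintegral => x _.
  by rewrite big_ord0.
rewrite big_ord_recr/= -IH -expectZ// -expectD.
- by apply: eq_Rintegral => x _; rewrite big_ord_recr.
- exact: bounded_measurable_sum.
- exact: bounded_measurableZ.
Qed.

Lemma le_expect u v : bounded_measurable u -> bounded_measurable v ->
  (forall x, u x <= v x) -> \int[P]_x u x <= \int[P]_x v x.
Proof.
by move=> bu bv uv; apply: le_Rintegral => //; exact: bounded_measurable_integrable.
Qed.

Lemma norm_expect_le u C : bounded_measurable u -> (forall x, `|u x| <= C) ->
  `|\int[P]_x u x| <= C.
Proof.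
move=> bu uC; rewrite ler_norml -(expect_cst (- C)) -{2}(expect_cst C).
apply/andP; split; (apply: le_expect => //; first by [exact: bounded_measurable_cst|exact: bu]) => x;
  by have := uC x; rewrite ler_norml => /andP[].
Qed.

Lemma EFin_expect u : bounded_measurable u ->
  (\int[P]_x (u x)%:E)%E = (\int[P]_x u x)%:E.
Proof.
move=> bu; rewrite /Rintegral fineK//; apply: integrable_fin_num => //.
exact: bounded_measurable_integrable.
Qed.

End BoundedExpectation.

(** * Ramp functions and piecewise linear interpolation *)

Section Interpolation.
Context {R : realType}.
Local Notation RM := (measurableTypeR R).

Lemma lipschitz_measurable (f : R -> R) (L : R) :
  (forall x y, `|f x - f y| <= L * `|x - y|) -> measurable_fun (setT : set RM) f.
Proof.
move=> fL; apply: continuous_measurable_fun => x; apply/cvgrPdist_le => e e0.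
have L0 : 0 < `|L| + 1 by rewrite ltr_wpDl.
near=> y; apply: (le_trans (fL _ _)).
apply: (@le_trans _ _ ((`|L| + 1) * `|x - y|)).
  by rewrite ler_wpM2r// (le_trans (ler_norm _))// lerDl.
rewrite mulrC -ler_pdivlMr//; near: y.
by apply: cvgr_dist_le; [exact: cvg_id|rewrite divr_gt0].
Unshelve. all: by end_near. Qed.

Variables (T h : R).
Definition node (k : nat) : R := - T + k%:R * h.

Let pospart (z : R) : R := Num.max z 0.

(** It is 0 up to node k, climbs with slope 1 over one cell, and stays at [h] afterwards. *)
Definition ramp (k : nat) (x : R) : R :=
  pospart (x - node k) - pospart (x - node k.+1).

(** The interpolant in telescoped form, with the slopes of [f] as coefficients; it is constant on
    either side of the grid. *)
Definition interpolant (f : R -> R) (N : nat) (x : R) : R :=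
  f (node 0) + \sum_(k < N) (f (node k.+1) - f (node k)) / h * ramp k x.

Hypothesis h0 : 0 < h.

Lemma nodeS k : node k.+1 = node k + h.
Proof. by rewrite /node -natr1 mulrDl mul1r addrA. Qed.

Let max0P (z : R) : (z < 0 /\ pospart z = 0) \/ (0 <= z /\ pospart z = z).
Proof.
rewrite /pospart;
have [z0|z0] := ltP z 0; first by left.
by right.
Qed.

Lemma ramp_le0 k (x : R) : x <= node k -> ramp k x = 0.
Proof.
move=> xk; rewrite /ramp nodeS /pospart !max_r ?subrr// subr_le0// (le_trans xk)//.
by rewrite lerDl ltW.
Qed.

Lemma ramp_ge k (x : R) : node k.+1 <= x -> ramp k x = h.
Proof.
rewrite /ramp nodeS /pospart => xk; rewrite !max_l; first by ring.
  by rewrite subr_ge0.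
by rewrite subr_ge0 (le_trans _ xk)// lerDl ltW.
Qed.

Lemma ramp_mid k (x : R) : node k <= x -> x <= node k.+1 -> ramp k x = x - node k.
Proof.
move=> kx xk; rewrite /ramp /pospart max_l ?subr_ge0// max_r ?subr_le0//.
by rewrite subr0.
Qed.

Lemma ramp_itv k (x : R) : 0 <= ramp k x <= h.
Proof.
have hp := h0.
have [xk|/ltW kx] := leP x (node k); first by rewrite ramp_le0// lexx ltW.
have [xk|/ltW kx'] := leP x (node k.+1); last by rewrite ramp_ge// lexx ltW.
rewrite ramp_mid// subr_ge0 kx/=; move: xk; rewrite nodeS; lra.
Qed.

Lemma ramp_nd k (x y : R) : x <= y -> ramp k x <= ramp k y.
Proof.
have hp := h0.
have hn : node k.+1 = node k + h by rewrite nodeS.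
rewrite /ramp => xy; move: (node k) (node k.+1) hn => p q pq.
by case: (max0P (x - p)) => -[? ->]; case: (max0P (x - q)) => -[? ->];
  case: (max0P (y - p)) => -[? ->]; case: (max0P (y - q)) => -[? ->]; lra.
Qed.

Lemma ramp_lip k (x y : R) : `|ramp k x - ramp k y| <= `|x - y|.
Proof.
have hp := h0.
have hn : node k.+1 = node k + h by rewrite nodeS.
wlog xy : x y / y <= x.
  move=> W; have [/W //|/ltW/W] := leP y x.
  by rewrite [`|x - y|]distrC [`|ramp k x - _|]distrC.
rewrite !ger0_norm ?subr_ge0 ?ramp_nd//.
rewrite /ramp; move: (node k) (node k.+1) hn => p q pq.
by case: (max0P (x - p)) => -[? ->]; case: (max0P (x - q)) => -[? ->];
  case: (max0P (y - p)) => -[? ->]; case: (max0P (y - q)) => -[? ->]; lra.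
Qed.

(** All increments have the same sign by monotonicity, so the absolute values can be summed without
    loss; the sum of the ramps telescopes to a clamp, which is 1-Lipschitz. *)
Lemma sum_ramp_lip N (x y : R) : \sum_(k < N) `|ramp k x - ramp k y| <= `|x - y|.
Proof.
have hp := h0.
wlog xy : x y / y <= x.
  move=> W; have [/W //|/ltW/W] := leP y x.
  rewrite [`|x - y|]distrC; congr (_ <= _).
  by apply: eq_bigr => k _; rewrite distrC.
have tele z : \sum_(k < N) ramp k z = pospart (z - node 0) - pospart (z - node N).
  rewrite -(big_mkord xpredT (fun k => ramp k z)) -[RHS]opprB.
  rewrite -(telescope_sumr (fun k => pospart (z - node k)))// -sumrN.
  by apply: eq_bigr => k _; rewrite opprB.
have n0N : node 0 <= node N.
  by rewrite /node lerD2l ler_wpM2r ?ler_nat ?(ltW hp).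
rewrite (eq_bigr (fun k : 'I_N => ramp k x - ramp k y)); last first.
  by move=> k _; rewrite ger0_norm// subr_ge0 ramp_nd.
rewrite sumrB !tele ger0_norm ?subr_ge0//.
move: (node 0) (node N) n0N => p q pq.
by case: (max0P (x - p)) => -[? ->]; case: (max0P (x - q)) => -[? ->];
  case: (max0P (y - p)) => -[? ->]; case: (max0P (y - q)) => -[? ->]; lra.
Qed.

Lemma ramp_bounded_measurable k : bounded_measurable (ramp k : RM -> R).
Proof.
split; last first.
  by exists h => x; have /andP[r0 rh] := ramp_itv k x; rewrite ger0_norm.
by apply: (@lipschitz_measurable _ 1) => x y; rewrite mul1r ramp_lip.
Qed.

Variables (f : R -> R) (M L : R).
Hypotheses (fM : forall x, `|f x| <= M)
  (fL : forall x y, `|f x - f y| <= L * `|x - y|).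

Lemma slope_le k : `|(f (node k.+1) - f (node k)) / h| <= L.
Proof.
rewrite normrM normfV (gtr0_norm h0) ler_pdivrMr//.
by apply: (le_trans (fL _ _)); rewrite nodeS addrC addKr gtr0_norm.
Qed.

Let interpolantS N (x : R) : interpolant f N.+1 x =
  interpolant f N x + (f (node N.+1) - f (node N)) / h * ramp N x.
Proof. by rewrite /interpolant big_ord_recr/= addrA. Qed.

Lemma interpolant_right N (x : R) : node N <= x -> interpolant f N x = f (node N).
Proof.
elim: N => [|N IH] xN; first by rewrite /interpolant big_ord0 addr0.
rewrite interpolantS IH; last by rewrite (le_trans _ xN)// nodeS lerDl ltW.
by rewrite ramp_ge// divfK ?gt_eqF// addrC subrK.
Qed.

Let interpolant_cell N (x : R) : node N <= x ->
  let t := ramp N x / h in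
  0 <= t <= 1 /\ interpolant f N.+1 x = (1 - t) * f (node N) + t * f (node N.+1).
Proof.
move=> xN t; split.
  have /andP[r0 rh] := ramp_itv N x.
  by rewrite /t divr_ge0 ?(ltW h0)//= ler_pdivrMr// mul1r.
rewrite interpolantS interpolant_right// /t; field.
by rewrite gt_eqF.
Qed.

Lemma interpolant_bound N (x : R) : `|interpolant f N x| <= M.
Proof.
have hp := h0.
elim: N x => [|N IH] x; first by rewrite /interpolant big_ord0 addr0.
have [xN|/ltW xN] := leP x (node N).
  by rewrite interpolantS ramp_le0// mulr0 addr0.
have [/andP[t0 t1] ->] := interpolant_cell xN; set t := _ / h in t0 t1 *.
have := fM (node N); have := fM (node N.+1).
rewrite !ler_norml => /andP[a1 a2] /andP[b1 b2]; apply/andP; split; nra.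
Qed.

(** At the fraction t of a cell, the weights 1 - t and t meet the distances t h and (1 - t) h, so
    the error is at most 2 t (1 - t) L h <= L h / 2. *)
Lemma interpolant_err N (x : R) : node 0 <= x -> x <= node N ->
  `|f x - interpolant f N x| <= L * h / 2.
Proof.
have hp := h0.
elim: N x => [|N IH] x x0 xN.
  have -> : x = node 0 by apply/eqP; rewrite eq_le x0 xN.
  have L0 : 0 <= L.
    have := le_trans (normr_ge0 _) (fL 1 0).
    by rewrite subr0 normr1 mulr1.
  rewrite /interpolant big_ord0 addr0 subrr normr0 divr_ge0 ?mulr_ge0//.
  exact: ltW.
have [xN'|/ltW xN'] := leP x (node N).
  by rewrite interpolantS ramp_le0// mulr0 addr0 IH.
have [/andP[t0 t1] ->] := interpolant_cell xN'.
rewrite ramp_mid// in t0 t1 *.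
set t := _ / h in t0 t1 *.
have xE : x - node N = t * h by rewrite /t divfK ?gt_eqF.
have xE' : node N.+1 - x = (1 - t) * h by rewrite nodeS; lra.
have L0 : 0 <= L.
  have := le_trans (normr_ge0 _) (fL 1 0).
  by rewrite subr0 normr1 mulr1.
have e1 : `|t * h| = t * h by rewrite ger0_norm// mulr_ge0// ltW.
have e2 : `|(1 - t) * h| = (1 - t) * h.
  by rewrite ger0_norm// mulr_ge0 ?subr_ge0// ltW.
have := fL x (node N); rewrite xE e1.
have := fL x (node N.+1); rewrite [`|x - _|]distrC xE' e2.
rewrite !ler_norml => /andP[a1 a2] /andP[b1 b2].
have Lh : 0 <= L * h by rewrite mulr_ge0// ltW.
have tt : (1 - t) * (L * (t * h)) + t * (L * ((1 - t) * h)) <= L * h / 2.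
  have := sqr_ge0 (2 * t - 1); nra.
have s0 : 0 <= 1 - t by lra.
have u1 := ler_wpM2l s0 b1; have u2 := ler_wpM2l s0 b2.
have v1 := ler_wpM2l t0 a1; have v2 := ler_wpM2l t0 a2.
by apply/andP; split; lra.
Qed.

(** Outside [-T, T] the trivial error 2 M is at most 2 M x^2 / T^2. This pointwise Chebyshev bound
    leaves only second moments to control, both for the sample and for the Gaussian laws. *)
Lemma interpolant_err_sqr N (x : R) : 0 < T -> node N >= T ->
  `|f x - interpolant f N x| <= L * h / 2 + 2 * M * (x ^+ 2 / T ^+ 2).
Proof.
have hp := h0.
move=> T0 NT.
have M0 : 0 <= M by rewrite (le_trans _ (fM 0)).
have n0 : node 0 = - T by rewrite /node mul0r addr0.
have L0 : 0 <= L.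
  have := le_trans (normr_ge0 _) (fL 1 0).
  by rewrite subr0 normr1 mulr1.
have q0 : 0 <= x ^+ 2 / T ^+ 2 by rewrite divr_ge0 ?sqr_ge0.
have [xT|xT] := leP `|x| T.
  move: xT; rewrite ler_norml => /andP[x1 x2].
  apply: (@le_trans _ _ (L * h / 2)).
    by apply: interpolant_err; [rewrite n0|exact: le_trans x2 NT].
  by rewrite lerDl mulr_ge0// mulr_ge0.
have q1 : 1 <= x ^+ 2 / T ^+ 2.
  rewrite ler_pdivlMr ?exprn_gt0// mul1r -(real_normK (num_real x)).
  by rewrite lerXn2r ?nnegrE ?(ltW T0) ?(ltW xT).
apply: (@le_trans _ _ (2 * M)).
  rewrite (le_trans (ler_normB _ _))// mulr2n mulrDl mul1r lerD//.
  exact: interpolant_bound.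
have Lh : 0 <= L * h / 2 by rewrite divr_ge0 ?mulr_ge0 ?(ltW hp).
have : 2 * M * 1 <= 2 * M * (x ^+ 2 / T ^+ 2) by rewrite ler_wpM2l// mulr_ge0.
by lra.
Qed.

Lemma interpolant_bounded_measurable N : bounded_measurable (interpolant f N : RM -> R).
Proof.
split; last by exists M => x; exact: interpolant_bound.
apply: measurable_funD => //.
have [] := @bounded_measurable_sum R N (fun k => (f (node k.+1) - f (node k)) / h) _ ramp_bounded_measurable.
by [].
Qed.

End Interpolation.

(** * Gaussian expectations at different scales, and second moments *)

Section GaussianExpectation.
Context {R : realType}.
Local Notation RM := (measurableTypeR R).
Local Notation mu := (@lebesgue_measure R).
Local Notation gam := (@normal_prob R 0 1).

Lemma bounded_measurable_scale (u : RM -> R) (a : R) :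
  bounded_measurable u -> bounded_measurable (fun z : RM => u (a * z)).
Proof.
move=> [mu_ [C uC]]; split; last by exists C.
by apply: (measurableT_comp mu_); exact: measurable_funM.
Qed.

Lemma normal_expect (sigma : R) (f : RM -> R) : 0 < sigma -> bounded_measurable f ->
  fine (\int[normal_prob 0 sigma]_y (f y)%:E)%E = \int[gam]_z f (sigma * z).
Proof.
move=> s0 bf; have [mf [C fC]] := bf.
(* The change of variables holds for nonnegative functions, so a constant is added and then
   cancelled. *)
have bg : bounded_measurable (fun x : RM => f x + C).
  by apply: bounded_measurableD => //; exact: bounded_measurable_cst.
have g0 x : (0 <= (f x + C)%:E)%E.
  by rewrite lee_fin; have := fC x; rewrite ler_norml; lra.
have E : (\int[gam]_z (f (sigma * z) + C)%:E = \int[normal_prob 0 sigma]_z (f z + C)%:E)%E.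
  apply: (@gauss_normal_prob R sigma (fun y => (f y + C)%:E) s0) => //.
  by apply/measurable_EFinP; case: bg.
have bgs : bounded_measurable (fun z : RM => f (sigma * z) + C).
  by apply: bounded_measurableD; [exact: bounded_measurable_scale|exact: bounded_measurable_cst].
rewrite (EFin_expect gam bgs) (EFin_expect (normal_prob 0 sigma) bg) in E.
have {}E := EFin_inj E; move: E.
rewrite expectD; [|exact: bounded_measurable_scale|exact: bounded_measurable_cst].
rewrite expectD; [|by []|exact: bounded_measurable_cst].
rewrite !expect_cst => /addIr E.
exact: (esym E).
Qed.

Let scale_density (a b : R) (u : RM -> R) : 0 < a -> a <= b ->
  measurable_fun setT u -> (forall x, 0 <= u x) ->
  ((a / b)%:E * \int[gam]_z (u (a * z))%:E <= \int[gam]_z (u (b * z))%:E)%E.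
Proof.
move=> a0 ab mu_ u0; have b0 : 0 < b by exact: lt_le_trans ab.
have mE : measurable_fun setT (EFin \o u) by exact/measurable_EFinP.
have u0E x : (0 <= (u x)%:E)%E by rewrite lee_fin.
rewrite (@gauss_scale R a (EFin \o u)); [|by rewrite gt_eqF|by []|by []].
rewrite (@gauss_scale R b (EFin \o u)); [|by rewrite gt_eqF|by []|by []].
rewrite !gtr0_norm//.
have mpu : measurable_fun setT (fun x : RM => (normal_pdf 0 a x)%:E * (u x)%:E)%E.
  apply: emeasurable_funM => //; apply/measurable_EFinP; exact: measurable_normal_pdf.
rewrite -ge0_integralZl; first last.
- by rewrite lee_fin divr_ge0// ltW.
- by move=> x _; apply: mule_ge0; [rewrite lee_fin normal_pdf_ge0|exact: u0E].
- exact: mpu.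
- by [].
apply: ge0_le_int => x /=; rewrite -!EFinM lee_fin.
  by rewrite !mulr_ge0 ?normal_pdf_ge0 ?invr_ge0 ?(ltW a0) ?(ltW b0).
rewrite mulrA ler_wpM2r//.
rewrite (normal_pdfsE _ _ (lt0r_neq0 a0)) (normal_pdfsE _ _ (lt0r_neq0 b0)) !gtr0_norm//.
rewrite (_ : a / b * _ = b^-1 * normal_peak 1 * expR (- ((x - 0) ^+ 2 / (a ^+ 2 * 2)))); last first.
  by field; rewrite !gt_eqF.
rewrite ler_wpM2l ?mulr_ge0 ?invr_ge0 ?normal_peak_ge0 ?(ltW b0)//.
rewrite ler_expR lerN2 ler_wpM2l ?sqr_ge0// lef_pV2 ?posrE ?mulr_gt0 ?exprn_gt0//.
by rewrite ler_wpM2r// lerXn2r// nnegrE ltW.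
Qed.

(** [scale_density] for M + f and for M - f gives |q - t p| <= (1 - t) M, where t = a / b and p, q
    are the two expectations; adding (1 - t) |p| gives the factor 2. *)
Let expect_scale_compare (a b M : R) (f : RM -> R) : 0 < a -> a <= b ->
  bounded_measurable f -> (forall x, `|f x| <= M) ->
  `|\int[gam]_z f (a * z) - \int[gam]_z f (b * z)| <= 2 * M * (1 - a / b).
Proof.
move=> a0 ab bf fM.
have b0 : 0 < b by exact: lt_le_trans ab.
have t0 : 0 < a / b by rewrite divr_gt0.
have t1 : a / b <= 1 by rewrite ler_pdivrMr// mul1r.
have bs (c : R) := bounded_measurable_scale c bf.
have bk := @bounded_measurable_cst R.
have ea : `|\int[gam]_z f (a * z)| <= M by apply: norm_expect_le => // x; exact: fM.
have hp : a / b * (\int[gam]_z f (a * z) + M) <= \int[gam]_z f (b * z) + M.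
  have bD : bounded_measurable (fun x : RM => f x + M) by exact: bounded_measurableD.
  have := @scale_density a b _ a0 ab bD.1 _.
  rewrite !EFin_expect; [|exact: (bounded_measurable_scale _ bD)..].
  rewrite !expectD// !expect_cst -EFinM lee_fin; apply.
  by move=> x; have := fM x; rewrite ler_norml; lra.
have hm : a / b * (M - \int[gam]_z f (a * z)) <= M - \int[gam]_z f (b * z).
  have bD : bounded_measurable (fun x : RM => M - f x) by exact: bounded_measurableB.
  have := @scale_density a b _ a0 ab bD.1 _.
  rewrite !EFin_expect; [|exact: (bounded_measurable_scale _ bD)..].
  rewrite !expectB// !expect_cst -EFinM lee_fin; apply.
  by move=> x; have := fM x; rewrite ler_norml; lra.
move: ea hp hm t0 t1; set t := a / b; set p := \int[gam]_z _; set q := \int[gam]_z _.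
rewrite !ler_norml => /andP[e1 e2] hp hm t0 t1.
by apply/andP; split; nra.
Qed.

(** The error is at most 2 M |a^2 / sigma^2 - 1| for a <= sigma, but only M times that for a >
    sigma. The signed term expresses this asymmetry and vanishes on averaging over the points, which
    leaves 3/2 where a symmetric bound would leave 2 and exhaust the budget for sup f. *)
Lemma expect_scale_close (a sigma M : R) (f : RM -> R) : 0 <= a -> 0 < sigma ->
  bounded_measurable f -> (forall x, `|f x| <= M) ->
  `|\int[gam]_z f (a * z) - \int[gam]_z f (sigma * z)| <=
  M * (3 / 2 * `|a ^+ 2 / sigma ^+ 2 - 1| + 2^-1 * (1 - a ^+ 2 / sigma ^+ 2)).
Proof.
move=> a0 s0 bf fM.
have M0 : 0 <= M by rewrite (le_trans _ (fM 0)).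
have nf (c : R) : `|\int[gam]_z f (c * z)| <= M.
  by apply: norm_expect_le => [|x]; [exact: bounded_measurable_scale|exact: fM].
move: a0; rewrite le_eqVlt => /predU1P[<-|a0].
  rewrite expr0n/= mul0r sub0r normrN normr1 subr0.
  rewrite (le_trans (ler_normB _ _))// (le_trans (lerD (nf _) (nf _)))//; lra.
rewrite -expr_div_n.
have [as_|sa] := leP a sigma.
  apply: (le_trans (expect_scale_compare a0 as_ bf fM)).
  have : 0 < a / sigma by rewrite divr_gt0.
  have : a / sigma <= 1 by rewrite ler_pdivrMr// mul1r.
  move: (a / sigma) => t t1 t0.
  have tt : t ^+ 2 <= t by rewrite expr2 ger_pMl.
  rewrite ler0_norm; last by rewrite subr_le0 (le_trans tt).
  rewrite [2 * M]mulrC -(mulrA M 2) ler_wpM2l//; lra.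
rewrite distrC; apply: (le_trans (expect_scale_compare s0 (ltW sa) bf fM)).
have sE : a / sigma = (sigma / a)^-1 by rewrite invf_div.
have : 0 < sigma / a by rewrite divr_gt0.
have : sigma / a <= 1 by rewrite ler_pdivrMr// mul1r ltW.
rewrite sE; move: (sigma / a) => t t1 t0.
have [q0 qt] : 0 < t^-1 /\ t^-1 * t = 1 by rewrite invr_gt0 mulVf// gt_eqF.
have q1 : 1 <= t^-1 by rewrite invf_ge1.
move: (t^-1) q0 qt q1 => q q0 qt q1.
have qq : 1 <= q ^+ 2 by rewrite expr_ge1// ltW.
rewrite ger0_norm ?subr_ge0// [2 * M]mulrC -(mulrA M 2) ler_wpM2l//.
have : q * (1 - t) = q - 1 by rewrite mulrBr mulr1 qt.
have : 0 <= (q - 1) * (1 - t) by rewrite mulr_ge0// subr_ge0.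
have : 0 <= (q - 1) ^+ 2 by exact: sqr_ge0.
by rewrite expr2; nra.
Qed.

(** From 1 + z^2 / 4 <= exp (z^2 / 4), whose mean is sqrt 2 <= 3/2. The crude 2 in place of 1 fits
    into the budget. *)
Lemma gauss_second_moment : (\int[gam]_z (z ^+ 2)%:E <= 2%:E)%E.
Proof.
have m2 : measurable_fun setT (fun z : RM => (z ^+ 2)%:E).
  by apply/measurable_EFinP; exact: measurable_funX.
have h4 : (4^-1 < 2^-1 :> R) by lra.
have I0 : (0 <= \int[gam]_z (z ^+ 2)%:E)%E.
  by apply: integral_ge0 => z _; rewrite lee_fin sqr_ge0.
have : (1 + 4^-1%:E * \int[gam]_z (z ^+ 2)%:E <= \int[gam]_z (expR (4^-1 * z ^+ 2))%:E)%E.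
  rewrite -[X in (X + _ <= _)%E](@gauss_cst R 1) -ge0_integralZl; first last.
  - by rewrite lee_fin.
  - by move=> x _; rewrite lee_fin sqr_ge0.
  - exact: m2.
  - by [].
  rewrite -ge0_integralD; first last.
  - by apply: emeasurable_funM.
  - by move=> x _; rewrite mule_ge0// lee_fin ?sqr_ge0.
  - by [].
  - by [].
  - by [].
  apply: ge0_le_int => z; first by rewrite adde_ge0// mule_ge0// lee_fin sqr_ge0.
  by rewrite -EFinM -EFinD lee_fin expR_ge1Dx.
rewrite gauss_exp_sqr//.
have s32 : ((Num.sqrt (1 - 2 * 4^-1 : R))^-1 <= 3 / 2).
  have -> : 1 - 2 * 4^-1 = 2^-1 :> R by field.
  have s0 : 0 < Num.sqrt (2^-1 : R) by rewrite sqrtr_gt0.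
  have s2 : Num.sqrt (2^-1 : R) ^+ 2 = 2^-1 by rewrite sqr_sqrtr.
  rewrite -(ler_pM2r s0) mulVf ?gt_eqF//.
  move: (Num.sqrt _) s0 s2 => s s0 s2; rewrite expr2 in s2; nra.
case: (\int[gam]_z _)%E I0 => [I| |] I0 //; last first.
  by rewrite mulry gtr0_sg// mul1e.
rewrite -EFinM -EFinD !lee_fin => h; lra.
Qed.

Lemma expect_growth (a c0 c1 : R) (u : RM -> R) : 0 <= c0 -> 0 <= c1 ->
  bounded_measurable u -> (forall x, `|u x| <= c0 + c1 * x ^+ 2) ->
  `|\int[gam]_z u (a * z)| <= c0 + 2 * c1 * a ^+ 2.
Proof.
move=> c00 c10 bu uc.
have bua := bounded_measurable_scale a bu.
apply: (@le_trans _ _ (\int[gam]_z `|u (a * z)|)).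
  by apply: le_normr_Rintegral => //; exact: bounded_measurable_integrable.
have bn : bounded_measurable (fun z : RM => `|u (a * z)|).
  have [m [C uC]] := bua; split; first exact: measurableT_comp.
  by exists C => x; rewrite normr_id.
rewrite -lee_fin -EFin_expect//.
have m2 : measurable_fun setT (fun z : RM => (z ^+ 2)%:E).
  by apply/measurable_EFinP; exact: measurable_funX.
have ca0 : 0 <= c1 * a ^+ 2 by rewrite mulr_ge0// sqr_ge0.
apply: (@le_trans _ _ (\int[gam]_z (c0%:E + (c1 * a ^+ 2)%:E * (z ^+ 2)%:E))%E).
  apply: ge0_le_int => z; first by rewrite lee_fin.
  by rewrite -EFinM -EFinD lee_fin (le_trans (uc _))// exprMn mulrA.
rewrite ge0_integralD; first last.
- by apply: emeasurable_funM.
- by move=> x _; rewrite mule_ge0// lee_fin ?sqr_ge0.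
- by [].
- by move=> x _; rewrite lee_fin.
- by [].
rewrite gauss_cst ge0_integralZl; first last.
- by rewrite lee_fin.
- by move=> x _; rewrite lee_fin sqr_ge0.
- exact: m2.
- by [].
rewrite EFinD leeD2l// (_ : 2 * c1 * a ^+ 2 = c1 * a ^+ 2 * 2); last by ring.
by rewrite (EFinM _ 2) lee_wpmul2l ?lee_fin// gauss_second_moment.
Qed.

End GaussianExpectation.

(** * Deterministic passage from ramp deviations to all test functions *)

Section Deterministic.
Context {R : realType}.
Local Notation RM := (measurableTypeR R).
Local Notation gam := (@normal_prob R 0 1).

Definition avg (n : nat) (g : 'I_n -> R) : R := n%:R^-1 * \sum_(i < n) g i.

Lemma eq_avg n (g g' : 'I_n -> R) : g =1 g' -> avg g = avg g'.
Proof. by move=> gg; rewrite /avg (eq_bigr g'). Qed.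

Lemma avgB n (g g' : 'I_n -> R) : avg (fun i => g i - g' i) = avg g - avg g'.
Proof. by rewrite /avg sumrB mulrBr. Qed.

Lemma avgD n (g g' : 'I_n -> R) : avg (fun i => g i + g' i) = avg g + avg g'.
Proof. by rewrite /avg big_split mulrDr. Qed.

Lemma avgZ n (k : R) (g : 'I_n -> R) : avg (fun i => k * g i) = k * avg g.
Proof. by rewrite /avg -mulr_sumr mulrCA. Qed.

Lemma avg_cst n (k : R) : (0 < n)%N -> avg (fun _ : 'I_n => k) = k.
Proof.
move=> n0; rewrite /avg sumr_const card_ord -[k *+ n]mulr_natl mulrA mulVf ?mul1r//.
by rewrite pnatr_eq0 -lt0n.
Qed.

Lemma le_avg n (g g' : 'I_n -> R) : (forall i, g i <= g' i) -> avg g <= avg g'.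
Proof. by move=> gg; rewrite /avg ler_wpM2l ?invr_ge0// ler_sum. Qed.

Lemma norm_avg n (g : 'I_n -> R) : `|avg g| <= avg (fun i => `|g i|).
Proof.
by rewrite /avg normrM ger0_norm ?invr_ge0// ler_wpM2l ?invr_ge0// ler_norm_sum.
Qed.

Lemma avg_sum n N (g : nat -> 'I_n -> R) :
  avg (fun i => \sum_(k < N) g k i) = \sum_(k < N) avg (g k).
Proof. by rewrite /avg exchange_big mulr_sumr. Qed.

Lemma sqnorm_ge0 d (u : 'rV[R]_d) : 0 <= sqnorm u.
Proof. by apply: sumr_ge0 => j _; exact: sqr_ge0. Qed.

(* The variance of <theta, x> under a standard Gaussian theta / sqrt d is
   [rms x ^+ 2]. *)
Definition rms d (x : 'rV[R]_d) : R := Num.sqrt (sqnorm x / d%:R).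

Definition mean_ramp n d (x : 'I_n -> 'rV[R]_d) (T h : R) (k : nat) : R :=
  avg (fun i => \int[gam]_z ramp T h k (rms (x i) * z)).

Lemma sqr_rms d (x : 'rV[R]_d) : rms x ^+ 2 = sqnorm x / d%:R.
Proof. by rewrite sqr_sqrtr// divr_ge0// sqnorm_ge0. Qed.

(** Four replacements: f by its interpolant on the sample, sample averages by Gaussian means, the
    interpolant by f again, the mixture by N(0, sigma^2). With mesh 3 eps / 4 and B / T^2 = eps / 36
    they cost, in units of eps, 3/8 L + M/18, then L/5, then 3/8 L + M/9, then 3/4 M. The total
    19/20 L + 11/12 M is at most M + L. *)
Lemma empirical_close (d n : nat) (x : 'I_n -> 'rV[R]_d) (theta : 'rV[R]_d)
    (sigma A B eps T : R) (N : nat) (f : R -> R) :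
  (0 < d)%N -> (0 < n)%N -> 0 < sigma -> 0 < eps -> 0 < B -> 0 < T ->
  avg (fun i => sqnorm (x i)) = sigma ^+ 2 * d%:R ->
  avg (fun i => `|sigma ^- 2 * sqnorm (x i) - d%:R|) <= A ->
  avg (fun i => dotp theta (x i) ^+ 2) <= B ->
  sigma ^+ 2 <= B -> A <= eps * d%:R / 2 ->
  T ^+ 2 = 36 * B / eps -> T <= node T (3 / 4 * eps) N ->
  BL_le1 f ->
  \sum_(k < N) `|emp_proj_int x theta (ramp T (3 / 4 * eps) k) -
                 mean_ramp x T (3 / 4 * eps) k| <= eps / 5 ->
  `|emp_proj_int x theta f - fine (\int[normal_prob 0 sigma]_y (f y)%:E)%E| <= eps.
Proof.
move=> d0 n0 s0 e0 B0 T0 avs avA avB sB Ae T2 TN [M [L [fM [fL ML]]]] Dle.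
set h := 3 / 4 * eps in TN Dle *.
have h0 : 0 < h by rewrite mulr_gt0.
have M0 : 0 <= M by rewrite (le_trans _ (fM 0)).
have L0 : 0 <= L.
  have := le_trans (normr_ge0 _) (fL 1 0).
  by rewrite subr0 normr1 mulr1.
have dR : 0 < d%:R :> R by rewrite ltr0n.
have s20 : 0 < sigma ^+ 2 by rewrite exprn_gt0.
have T20 : 0 < T ^+ 2 by rewrite exprn_gt0.
have bf : bounded_measurable (f : RM -> R).
  by split; [exact: (lipschitz_measurable fL)|exists M].
have bft : bounded_measurable (interpolant T h f N : RM -> R).
  by apply: (interpolant_bounded_measurable _ h0 fM).
have err y : `|f y - interpolant T h f N y| <= L * h / 2 + 2 * M / T ^+ 2 * y ^+ 2.
  rewrite (_ : 2 * M / T ^+ 2 * y ^+ 2 = 2 * M * (y ^+ 2 / T ^+ 2)); last by ring.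
  exact: (interpolant_err_sqr h0 fM fL y T0 TN).
have Lh0 : 0 <= L * h / 2 by apply: divr_ge0 => //; apply: mulr_ge0 => //; exact: ltW.
have MT0 : 0 <= 2 * M / T ^+ 2 by apply: divr_ge0; [exact: mulr_ge0|exact: ltW].
pose y i := dotp theta (x i).
pose a i := rms (x i).
have ava : avg (fun i => a i ^+ 2) = sigma ^+ 2.
  rewrite (@eq_avg _ _ (fun i => d%:R^-1 * sqnorm (x i))); last first.
    by move=> i; rewrite /a sqr_rms mulrC.
  by rewrite avgZ avs mulrCA mulVf ?mulr1// gt_eqF.
rewrite normal_expect//.
have e1 : `|avg (f \o y) - avg (interpolant T h f N \o y)| <= L * h / 2 + 2 * M / T ^+ 2 * B.
  rewrite -avgB (le_trans (norm_avg _))// (@le_trans _ _ (avg (fun i => L * h / 2 + 2 * M / T ^+ 2 * y i ^+ 2)))//.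
    by apply: le_avg => i; exact: err.
  by rewrite avgD avg_cst// avgZ lerD2l ler_wpM2l.
have e2 : `|avg (interpolant T h f N \o y) -
            avg (fun i => \int[gam]_z interpolant T h f N (a i * z))| <= L * (eps / 5).
  have -> : avg (interpolant T h f N \o y) = f (node T h 0) +
      \sum_(k < N) (f (node T h k.+1) - f (node T h k)) / h * avg (ramp T h k \o y).
    rewrite /interpolant (@avgD _ (fun=> _)) avg_cst//; congr (_ + _).
    rewrite (@avg_sum n N (fun k i => (f (node T h k.+1) - f (node T h k)) / h * ramp T h k (y i))).
    by apply: eq_bigr => k _; rewrite avgZ.
  have -> : avg (fun i => \int[gam]_z interpolant T h f N (a i * z)) = f (node T h 0) +
      \sum_(k < N) (f (node T h k.+1) - f (node T h k)) / h * mean_ramp x T h k.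
    rewrite (@eq_avg _ _ (fun i => f (node T h 0) + \sum_(k < N) (f (node T h k.+1) - f (node T h k)) / h *
        \int[gam]_z ramp T h k (a i * z))); last first.
      move=> i; rewrite /interpolant expectD; first last.
      - have := @bounded_measurable_sum R N (fun k => (f (node T h k.+1) - f (node T h k)) / h)
          (fun k z => ramp T h k (a i * z)).
        by apply=> k; apply: bounded_measurable_scale; exact: ramp_bounded_measurable.
      - exact: bounded_measurable_cst.
      rewrite expect_cst; congr (_ + _).
      apply: (@expect_sum R gam N (fun k => (f (node T h k.+1) - f (node T h k)) / h)
          (fun k z => ramp T h k (a i * z))) => k.
      by apply: bounded_measurable_scale; exact: ramp_bounded_measurable.
    rewrite avgD avg_cst//; congr (_ + _).
    rewrite (@avg_sum n N (fun k i => (f (node T h k.+1) - f (node T h k)) / h *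
       \int[gam]_z ramp T h k (a i * z))).
    by apply: eq_bigr => k _; rewrite avgZ.
  rewrite opprD addrACA subrr add0r -sumrB (le_trans (ler_norm_sum _ _ _))//.
  apply: (@le_trans _ _ (L * \sum_(k < N) `|emp_proj_int x theta (ramp T h k) - mean_ramp x T h k|)).
    rewrite mulr_sumr; apply: ler_sum => k _; rewrite -mulrBr normrM.
    by rewrite ler_wpM2r// slope_le.
  by rewrite ler_wpM2l.
have e3 : `|avg (fun i => \int[gam]_z interpolant T h f N (a i * z)) -
            avg (fun i => \int[gam]_z f (a i * z))| <= L * h / 2 + 2 * (2 * M / T ^+ 2) * sigma ^+ 2.
  rewrite -avgB (le_trans (norm_avg _))//.
  rewrite (@le_trans _ _ (avg (fun i => L * h / 2 + 2 * (2 * M / T ^+ 2) * a i ^+ 2)))//; last first.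
    by rewrite avgD avg_cst// avgZ ava.
  apply: le_avg => i; rewrite -expectB; [|exact: bounded_measurable_scale|exact: bounded_measurable_scale].
  apply: (@expect_growth R (a i) _ _ (fun z => interpolant T h f N z - f z)) => //.
    exact: bounded_measurableB.
  by move=> z; rewrite distrC.
have e4 : `|avg (fun i => \int[gam]_z f (a i * z)) - \int[gam]_z f (sigma * z)| <=
    M * (3 / 2 * (A / d%:R)).
  rewrite -(@avg_cst n (\int[gam]_z f (sigma * z)))// -avgB (le_trans (norm_avg _))//.
  apply: (@le_trans _ _ (avg (fun i => M * (3 / 2 * `|a i ^+ 2 / sigma ^+ 2 - 1| +
      2^-1 * (1 - a i ^+ 2 / sigma ^+ 2))))).
    by apply: le_avg => i; apply: expect_scale_close => //; exact: sqrtr_ge0.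
  rewrite avgZ avgD !avgZ avgB avg_cst//.
  (* The definition of sigma cancels the signed term of [expect_scale_close]. *)
  have -> : avg (fun i => a i ^+ 2 / sigma ^+ 2) = 1.
    rewrite (@eq_avg _ _ (fun i => (sigma ^+ 2)^-1 * a i ^+ 2)); last by move=> i; rewrite mulrC.
    by rewrite avgZ ava mulVf// gt_eqF.
  rewrite subrr mulr0 addr0 !ler_wpM2l//.
  rewrite (@eq_avg _ _ (fun i => d%:R^-1 * `|sigma ^- 2 * sqnorm (x i) - d%:R|)); last first.
    move=> i; rewrite /a sqr_rms -{2}(@ger0_norm _ d%:R^-1) ?invr_ge0 ?(ltW dR)// -normrM.
    by congr `|_|; field; rewrite !gt_eqF.
  by rewrite avgZ mulrC ler_wpM2r ?invr_ge0 ?(ltW dR).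
have MT : 2 * M / T ^+ 2 * B = M * eps / 18.
  by rewrite T2; field; rewrite !gt_eqF.
have Ms : 2 * M / T ^+ 2 * sigma ^+ 2 <= M * eps / 18 by rewrite -MT ler_wpM2l.
have MA : M * (3 / 2 * (A / d%:R)) <= M * (3 / 4 * eps).
  rewrite ler_wpM2l//.
  have : A / d%:R <= eps / 2 by rewrite ler_pdivrMr// mulrAC.
  lra.
have Me : M * eps + L * eps <= eps by rewrite -mulrDl ler_piMl// ltW.
have Me0 : 0 <= M * eps by rewrite mulr_ge0// ltW.
have Le0 : 0 <= L * eps by rewrite mulr_ge0// ltW.
have Lh : L * h = 3 / 4 * (L * eps) by rewrite /h mulrCA.
have E : emp_proj_int x theta f = avg (f \o y) by [].
rewrite E; move: e1 e2 e3 e4; rewrite MT Lh.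
move: (avg _) (avg _) (avg _) (avg _) (\int[gam]_z _) => p1 p2 p3 p4 p5.
rewrite !ler_norml => /andP[? ?] /andP[? ?] /andP[? ?] /andP[? ?].
apply/andP; split; lra.
Qed.

End Deterministic.

(** * Concentration of the ramp averages and transfer to the sphere *)

Section Concentration.
Context {R : realType}.
Local Notation RM := (measurableTypeR R).
Local Notation gam := (@normal_prob R 0 1).

(** Cauchy-Schwarz in the form |g| <= g^2 / (2 c) + c / 2. *)
Let avg_norm_le_pos n (g : 'I_n -> R) (c : R) : (0 < n)%N -> 0 < c ->
  avg (fun i => g i ^+ 2) <= c ^+ 2 -> avg (fun i => `|g i|) <= c.
Proof.
move=> n0 c0 gc.
apply: (@le_trans _ _ (avg (fun i => (2 * c)^-1 * g i ^+ 2 + c / 2))).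
  apply: le_avg => i; rewrite -(ler_pM2l (_ : 0 < 2 * c)) ?mulr_gt0//.
  rewrite mulrDr mulrA divff ?mulf_neq0 ?gt_eqF// mul1r -(real_normK (num_real (g i))).
  by have := sqr_ge0 (`|g i| - c); nra.
rewrite avgD (avgZ _ (fun i => g i ^+ 2)) avg_cst//.
apply: (@le_trans _ _ ((2 * c)^-1 * c ^+ 2 + c / 2)).
  by rewrite lerD2r ler_wpM2l// invr_ge0 mulr_ge0// ltW.
rewrite le_eqVlt; apply/orP; left; apply/eqP; field.
by rewrite gt_eqF.
Qed.

Lemma avg_norm_le n (g : 'I_n -> R) (c : R) : (0 < n)%N -> 0 <= c ->
  avg (fun i => g i ^+ 2) <= c ^+ 2 -> avg (fun i => `|g i|) <= c.
Proof.
move=> n0 c0 gc; apply/ler_addgt0Pr => e e0.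
apply: avg_norm_le_pos => //; first by rewrite ltr_wpDl.
by apply: (le_trans gc); rewrite lerXn2r ?nnegrE ?addr_ge0 ?(ltW e0)// lerDl ltW.
Qed.

Lemma dotpZl d (k : R) (u v : 'rV[R]_d) : dotp (k *: u) v = k * dotp u v.
Proof. by rewrite /dotp mulr_sumr; apply: eq_bigr => j _; rewrite mxE mulrA. Qed.

Lemma dotpBl d (u u' v : 'rV[R]_d) : dotp (u - u') v = dotp u v - dotp u' v.
Proof.
by rewrite /dotp -sumrB; apply: eq_bigr => j _; rewrite !mxE mulrBl.
Qed.

Lemma sqnormZ d (k : R) (u : 'rV[R]_d) : sqnorm (k *: u) = k ^+ 2 * sqnorm u.
Proof. by rewrite /sqnorm mulr_sumr; apply: eq_bigr => j _; rewrite mxE exprMn. Qed.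

Lemma sqnorm_eq0 d (u : 'rV[R]_d) : sqnorm u = 0 -> u = 0.
Proof.
move=> /psumr_eq0P u0; apply/rowP => j; rewrite mxE; apply/eqP.
by rewrite -sqrf_eq0 u0// => i _; exact: sqr_ge0.
Qed.

Lemma second_moment_homogeneous n d (x : 'I_n -> 'rV[R]_d) (B : R) :
  (forall theta, unit_sphere d theta -> avg (fun i => dotp theta (x i) ^+ 2) <= B) ->
  forall w, avg (fun i => dotp w (x i) ^+ 2) <= B * sqnorm w.
Proof.
move=> xB w; have [w0|w0] := eqVneq (sqnorm w) 0.
  have z i : dotp w (x i) = 0.
    by rewrite (sqnorm_eq0 w0) /dotp big1// => j _; rewrite mxE mul0r.
  rewrite w0 mulr0 /avg big1 ?mulr0// => i _.
  by rewrite z expr0n.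
have w1 : 0 < sqnorm w by rewrite lt_neqAle eq_sym w0 sqnorm_ge0.
have r0 : 0 < Num.sqrt (sqnorm w) by rewrite sqrtr_gt0.
have := xB ((Num.sqrt (sqnorm w))^-1 *: w).
rewrite /unit_sphere/= sqnormZ exprVn sqr_sqrtr ?sqnorm_ge0// mulVf// => /(_ erefl).
rewrite (@eq_avg _ _ _ (fun i => (sqnorm w)^-1 * dotp w (x i) ^+ 2)); last first.
  by move=> i; rewrite dotpZl exprMn exprVn sqr_sqrtr// sqnorm_ge0.
by rewrite avgZ mulrC ler_pdivrMr.
Qed.

Definition rowv d (v : nat -> R) : 'rV[R]_d := \row_(j < d) v j.

Lemma sqnorm_rowv d v : sqnorm (rowv d v) = sqn d v.
Proof. by rewrite /sqnorm /sqn; apply: eq_bigr => j _; rewrite mxE. Qed.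

Lemma measurable_dotp_rowv d (y : 'rV[R]_d) d' (Om : measurableType d')
    (c : nat -> Om -> R) : (forall j, measurable_fun setT (c j)) ->
  measurable_fun setT (fun w => dotp (rowv d (fun j => c j w)) y).
Proof.
move=> mc; rewrite (_ : (fun w => _) = (fun w => \sum_(j < d) c j w * y 0 j)).
  by apply: measurable_sum => j; exact: measurable_funM.
by apply/funext => w; apply: eq_bigr => j _; rewrite mxE.
Qed.

Definition gauss_ramp n d (x : 'I_n -> 'rV[R]_d) (T h : R) (k : nat) (v : nat -> R) : R :=
  avg (fun i => ramp T h k (dotp (rowv d v) (x i) / Num.sqrt d%:R)).

Lemma measurable_gauss_ramp n d (x : 'I_n -> 'rV[R]_d) T h k d' (Om : measurableType d')
    (c : nat -> Om -> R) : 0 < h -> (forall j, measurable_fun setT (c j)) ->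
  measurable_fun setT (fun w => gauss_ramp x T h k (fun j => c j w)).
Proof.
move=> h0 mc; apply: measurable_funM => //; apply: measurable_sum => i.
have [mr _] := ramp_bounded_measurable T h0 k.
apply: (measurableT_comp mr); apply: measurable_funM => //.
exact: measurable_dotp_rowv.
Qed.

Lemma gauss_ramp_itv n d (x : 'I_n -> 'rV[R]_d) T h k v : (0 < n)%N -> 0 < h ->
  0 <= gauss_ramp x T h k v <= h.
Proof.
move=> n0 h0; apply/andP; split.
  rewrite -[leLHS](avg_cst 0 n0); apply: le_avg => i.
  by have /andP[] := ramp_itv T h0 k (dotp (rowv d v) (x i) / Num.sqrt d%:R).
rewrite -[leRHS](avg_cst h n0); apply: le_avg => i.
by have /andP[] := ramp_itv T h0 k (dotp (rowv d v) (x i) / Num.sqrt d%:R).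
Qed.

Lemma gauss_ramp_mean n d (x : 'I_n -> 'rV[R]_d) T h k : (0 < n)%N -> (0 < d)%N -> 0 < h ->
  itint gam d (EFin \o gauss_ramp x T h k) = (mean_ramp x T h k)%:E.
Proof.
move=> n0 d0 h0; have br := ramp_bounded_measurable T h0 k.
have r0 z : 0 <= ramp T h k z by have /andP[] := ramp_itv T h0 k z.
pose g i (v : nat -> R) : \bar R :=
  (ramp T h k (dotp (rowv d v) (x i) / Num.sqrt d%:R))%:E.
have g0 i v : (0 <= g i v)%E by rewrite lee_fin.
have mg i : cmeas (g i).
  move=> d' Om c mc; apply/measurable_EFinP; apply: (measurableT_comp br.1).
  by apply: measurable_funM => //; exact: measurable_dotp_rowv.
transitivity (itint gam d (fun v => (n%:R^-1)%:E * \sum_(i < n) g i v)%E).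
  by apply: eq_itint => v; rewrite /= /gauss_ramp /avg EFinM -sumEFin.
rewrite itintZ; first last.
- by move=> d' Om c mc; apply: emeasurable_sum => i; exact: mg.
- by move=> v; exact: sume_ge0.
- by rewrite lee_fin invr_ge0.
rewrite itint_sum// /mean_ramp /avg EFinM -sumEFin; congr (_ * _)%E.
apply: eq_bigr => i _.
(* [itint_gauss_linear] takes coefficients indexed by [nat], so the row is extended by 0. *)
pose w (j : nat) : R := (if insub j is Some o then x i 0 (o : 'I_d) else 0) / Num.sqrt d%:R.
have wE (j : 'I_d) : w j = x i 0 j / Num.sqrt d%:R by rewrite /w valK.
transitivity (itint gam d (fun v => (ramp T h k (\sum_(j < d) v j * w j))%:E)).
  apply: eq_itint => v; congr ((ramp T h k _)%:E).
  rewrite /dotp mulr_suml; apply: eq_bigr => j _.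
  by rewrite wE mxE mulrA.
rewrite (itint_gauss_linear d w (f := EFin \o ramp T h k)); first last.
- by move=> z; rewrite lee_fin.
- by apply/measurable_EFinP; exact: br.1.
have -> : Num.sqrt (sqn d w) = rms (x i).
  rewrite /rms /sqn /sqnorm mulr_suml; congr (Num.sqrt _).
  by apply: eq_bigr => j _; rewrite wE exprMn exprVn sqr_sqrtr.
exact: (EFin_expect gam (bounded_measurable_scale _ br)).
Qed.

(** Each ramp is 1-Lipschitz, so the difference is at most the average of |<u - v, x_i>| / sqrt d;
    Cauchy-Schwarz over i and the bound [B] in the direction u - v conclude. *)
Lemma gauss_ramp_lip n d (x : 'I_n -> 'rV[R]_d) T h k (B : R) u v :
  (0 < n)%N -> (0 < d)%N -> 0 < h -> 0 < B ->
  (forall theta, unit_sphere d theta -> avg (fun i => dotp theta (x i) ^+ 2) <= B) ->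
  gauss_ramp x T h k u - gauss_ramp x T h k v <=
  Num.sqrt (B / d%:R) * Num.sqrt (sqn d (fun j => u j - v j)).
Proof.
move=> n0 d0 h0 B0 xB; rewrite -avgB.
have dR : 0 < d%:R :> R by rewrite ltr0n.
have bd0 : 0 <= B / d%:R by rewrite divr_ge0// ltW.
apply: (@le_trans _ _ (avg (fun i =>
    `|dotp (rowv d (fun j => u j - v j)) (x i) / Num.sqrt d%:R|))).
  apply: le_avg => i; apply: (le_trans (ler_norm _)).
  apply: (le_trans (ramp_lip T h0 k _ _)); rewrite -mulrBl -dotpBl.
  by rewrite (_ : rowv d u - rowv d v = rowv d (fun j => u j - v j))//; apply/rowP => j; rewrite !mxE.
apply: avg_norm_le; [by []|by apply: mulr_ge0; rewrite ?sqrtr_ge0|].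
rewrite exprMn !sqr_sqrtr ?sqn_ge0//.
rewrite (@eq_avg _ _ _ (fun i => d%:R^-1 * dotp (rowv d (fun j => u j - v j)) (x i) ^+ 2)); last first.
  by move=> i; rewrite exprMn exprVn sqr_sqrtr ?(ltW dR)// mulrC.
rewrite avgZ mulrAC mulrC ler_wpM2r ?invr_ge0 ?(ltW dR)//.
by rewrite -sqnorm_rowv; exact: second_moment_homogeneous.
Qed.

(* Replacing the unit vector v / |v| by v / sqrt d. *)
Lemma ramp_radial n d (x : 'I_n -> 'rV[R]_d) T h N (B delta : R) v :
  (0 < n)%N -> (0 < d)%N -> 0 < h -> 0 < B -> 0 <= delta < 1 ->
  (forall theta, unit_sphere d theta -> avg (fun i => dotp theta (x i) ^+ 2) <= B) ->
  `|Num.sqrt (sqn d v) - Num.sqrt d%:R| <= delta * Num.sqrt d%:R ->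
  \sum_(k < N) `|emp_proj_int x (rowv d (fun j => v j / Num.sqrt (sqn d v))) (ramp T h k) -
                 gauss_ramp x T h k v| <= delta * Num.sqrt B.
Proof.
move=> n0 d0 h0 B0 /andP[de0 de1] xB rad.
set r := Num.sqrt (sqn d v) in rad *; set s := Num.sqrt d%:R in rad *.
have dR : 0 < d%:R :> R by rewrite ltr0n.
have s0 : 0 < s by rewrite sqrtr_gt0.
have r0 : 0 < r.
  by move: rad; rewrite ler_norml => /andP[r1 _]; nra.
have r2 : r ^+ 2 = sqn d v by rewrite sqr_sqrtr ?sqn_ge0.
pose th := rowv d (fun j => v j / r).
have thS : unit_sphere d th.
  rewrite /unit_sphere/= sqnorm_rowv /sqn.
  rewrite (eq_bigr (fun j : 'I_d => r ^- 2 * v j ^+ 2)); last first.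
    by move=> j _; rewrite exprMn exprVn mulrC.
  by rewrite -mulr_sumr -/(sqn d v) -r2 mulVf// expf_neq0// gt_eqF.
have vE : rowv d v = r *: th by apply/rowP => j; rewrite !mxE mulrC divfK// gt_eqF.
apply: (@le_trans _ _ (avg (fun i => \sum_(k < N)
    `|ramp T h k (dotp th (x i)) - ramp T h k (dotp (rowv d v) (x i) / s)|))).
  rewrite (@avg_sum _ n N (fun k i => `|ramp T h k (dotp th (x i)) - ramp T h k (dotp (rowv d v) (x i) / s)|)).
  apply: ler_sum => k _; apply: le_trans (norm_avg _).
  by rewrite avgB.
apply: (@le_trans _ _ (avg (fun i => `|(1 - r / s) * dotp th (x i)|))).
  apply: le_avg => i; apply: (le_trans (sum_ramp_lip T h0 N _ _)).
  by rewrite vE dotpZl mulrBl mul1r mulrAC.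
apply: avg_norm_le; [by []|by apply: mulr_ge0; rewrite ?sqrtr_ge0|].
rewrite (@eq_avg _ _ _ (fun i => (1 - r / s) ^+ 2 * dotp th (x i) ^+ 2)); last first.
  by move=> i; rewrite exprMn.
rewrite avgZ exprMn sqr_sqrtr ?(ltW B0)//; apply: ler_pM; rewrite ?sqr_ge0//.
- by rewrite /avg mulr_ge0 ?invr_ge0// sumr_ge0// => i _; exact: sqr_ge0.
- rewrite -(real_normK (num_real (1 - _))) lerXn2r ?nnegrE//.
  rewrite -(ler_pM2r s0) (_ : `|1 - r / s| * s = `|r - s|)//.
  rewrite -[X in _ * X](gtr0_norm s0) -normrM mulrBl mul1r divfK ?gt_eqF//.
  by rewrite distrC.
- exact: xB.
Qed.

(** The homogeneous majorant [psi] signals a total ramp deviation above eps / 5. This allowance is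
    halved: eps / 10 for the radial replacement, and eps / 10 for the N Gaussian deviations, eps /
    (10 N) each. The two terms of the bound are the norm tail and a union bound over the ramps. *)
Lemma sphere_dBL_tail (d n : nat) (x : 'I_n -> 'rV[R]_d) (sigma A B eps T delta : R) (N : nat) :
  (0 < d)%N -> (0 < n)%N -> 0 < sigma -> 0 < eps -> 0 < B -> 0 < T ->
  avg (fun i => sqnorm (x i)) = sigma ^+ 2 * d%:R ->
  avg (fun i => `|sigma ^- 2 * sqnorm (x i) - d%:R|) <= A ->
  (forall theta, unit_sphere d theta -> avg (fun i => dotp theta (x i) ^+ 2) <= B) ->
  sigma ^+ 2 <= B -> A <= eps * d%:R / 2 ->
  T ^+ 2 = 36 * B / eps -> T <= node T (3 / 4 * eps) N -> (0 < N)%N ->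
  0 < delta -> delta <= 2^-1 -> delta * Num.sqrt B <= eps / 10 ->
  sphere_prob [set theta | dBL_proj_normal x theta sigma > eps] <=
  2 * expR (- (d%:R * delta ^+ 2 / 8)) +
  N%:R * (2 * expR (- ((eps / (10 * N%:R)) ^+ 2 / (4 * (B / d%:R))))).
Proof.
move=> d0 n0 s0 e0 B0 T0 avs avA xB sB Ae T2 TN N0 de0 de1 deB.
set h := 3 / 4 * eps in TN *; set eta := eps / (10 * N%:R).
have h0 : 0 < h by rewrite mulr_gt0.
have NR : 0 < N%:R :> R by rewrite ltr0n.
have dR : 0 < d%:R :> R by rewrite ltr0n.
have eta0 : 0 < eta by rewrite divr_gt0// mulr_gt0.
pose dev (v : nat -> R) := \sum_(k < N)
  `|emp_proj_int x (rowv d (fun j => v j / Num.sqrt (sqn d v))) (ramp T h k) - mean_ramp x T h k|.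
pose psi v : \bar R := if eps / 5 < dev v then 1%E else 0%E.
have psi0 v : (0 <= psi v)%E by rewrite /psi; case: ifP.
pose rad v : \bar R := if delta * Num.sqrt d%:R < `|Num.sqrt (sqn d v) - Num.sqrt d%:R|
  then 1%E else 0%E.
have rad0 v : (0 <= rad v)%E by rewrite /rad; case: ifP.
pose bad k v : \bar R := if eta < `|gauss_ramp x T h k v - mean_ramp x T h k| then 1%E else 0%E.
have bad0 k v : (0 <= bad k v)%E by rewrite /bad; case: ifP.
have msqrt : measurable_fun setT (Num.sqrt : RM -> RM).
  by apply: continuous_measurable_fun; exact: sqrt_continuous.
have mpsi : cmeas psi.
  move=> d' Om c mc; apply: measurable_fun_ifT => //; apply: measurable_fun_ltr => //.
  apply: measurable_sum => k; apply: measurableT_comp => //; apply: measurable_funB => //.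
  apply: measurable_funM => //; apply: measurable_sum => i.
  apply: (measurableT_comp (ramp_bounded_measurable T h0 k).1).
  apply: (@measurable_dotp_rowv d (x i) _ Om (fun j w => c j w / Num.sqrt (sqn d (fun j => c j w)))) => j.
  apply: measurable_funM => //.
  have mq : measurable_fun setT (fun w => Num.sqrt (sqn d (fun j => c j w)) : RM).
    by apply: (measurableT_comp msqrt); exact: measurable_sqn.
  have mq0 : measurable_fun setT (fun w => (0 < sqn d (fun j => c j w))%R).
    by apply: measurable_fun_ltr => //; exact: measurable_sqn.
  (* Writing the inverse as exp (- ln) makes its measurability evident; at norm 0 both sides are 0,
     by the convention for the inverse of 0. *)
  rewrite (_ : (fun w => _) = (fun w => if (0 < sqn d (fun j => c j w))%R
      then expR (- ln (Num.sqrt (sqn d (fun j => c j w)))) else 0)).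
    apply: measurable_fun_ifT => //; apply: measurableT_comp => //.
    by apply: measurableT_comp => //; exact: (measurableT_comp (@measurable_ln R)).
  apply/funext => w; case: ifPn => q0; first by rewrite -lnV ?lnK ?posrE ?invr_gt0 ?sqrtr_gt0.
  by rewrite ler0_sqrtr ?invr0// leNgt.
have mrad : cmeas rad.
  move=> d' Om c mc; apply: measurable_fun_ifT => //; apply: measurable_fun_ltr => //.
  apply: measurableT_comp => //; apply: measurable_funB => //.
  by apply: (measurableT_comp msqrt); exact: measurable_sqn.
have mbad k : cmeas (bad k).
  move=> d' Om c mc; apply: measurable_fun_ifT => //; apply: measurable_fun_ltr => //.
  apply: measurableT_comp => //; apply: measurable_funB => //.
  exact: measurable_gauss_ramp.
apply: (@sphere_prob_le _ _ _ psi) => //.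
- move=> r v r0; rewrite /psi.
  have E : (fun j => r * v j / Num.sqrt (sqn d (fun j => r * v j))) =
      (fun j => v j / Num.sqrt (sqn d v)).
    apply/funext => j; rewrite sqn_scale sqrtrM ?sqr_ge0// sqrtr_sqr gtr0_norm//.
    by rewrite invfM mulrACA divff ?mul1r// gt_eqF.
  by rewrite /dev E.
- move=> v v1 /= bigd; rewrite /psi ifT//.
  rewrite ltNge; apply/negP => small.
  have rE : rowv d (fun j => v j / Num.sqrt (sqn d v)) = \row_j v j.
    by apply/rowP => j; rewrite !mxE v1 sqrtr1 divr1.
  rewrite /dev rE in small.
  (* A supremum above eps supplies a test function above eps; [f = 0] shows that the set is
     nonempty. *)
  have [|r [f [bf ->]]] := sup_gt _ bigd.
    exists 0; exists (fun=> 0); split.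
      exists 0, 0; split; first by move=> y; rewrite normr0.
      by split; [move=> y z; rewrite subrr normr0 mul0r|rewrite addr0].
    rewrite /emp_proj_int big1// mulr0; under eq_integral do [].
    by rewrite integral0 subrr normr0.
  rewrite ltNge => /negP; apply.
  apply: (empirical_close (A := A) (B := B) (T := T) (N := N)) => //.
  by apply: xB; rewrite /unit_sphere/= -[RHS]v1 -sqnorm_rowv.
have radT := gauss_norm_tail d de0 de1.
have badT k : (itint gam d (bad k) <= (2 * expR (- (eta ^+ 2 / (4 * (B / d%:R)))))%:E)%E.
  have bd0 : 0 < B / d%:R by rewrite divr_gt0.
  rewrite -(sqr_sqrtr (ltW bd0)).
  apply: (@gauss_concentration R d (gauss_ramp x T h k) (Num.sqrt (B / d%:R)) h) => //.
  - by move=> d' Om c mc; apply/measurable_EFinP; exact: measurable_gauss_ramp.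
  - by move=> v; have /andP[] := gauss_ramp_itv x T k v n0 h0.
  - by move=> v; have /andP[] := gauss_ramp_itv x T k v n0 h0.
  - by move=> u v; exact: gauss_ramp_lip.
  - exact: gauss_ramp_mean.
  - by rewrite sqrtr_gt0.
apply: (@le_trans _ _ (itint gam d (fun v => rad v + \sum_(k < N) bad k v)%E)).
  apply: le_itint => // v; rewrite /psi; case: ifPn => [dv|_]; last first.
    by rewrite adde_ge0// sume_ge0.
  rewrite /rad; case: ifPn => [_|].
    by rewrite leeDl// sume_ge0.
  rewrite -leNgt add0e => radv.
  (* If no ramp is bad and the norm is typical, the two halves of the allowance contradict a
     deviation above eps / 5. *)
  have [allsmall|] := pselect (forall k : 'I_N, `|gauss_ramp x T h k v - mean_ramp x T h k| <= eta).
    exfalso; move: dv; rewrite ltNge => /negP; apply.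
    apply: (@le_trans _ _ (\sum_(k < N) (`|emp_proj_int x (rowv d (fun j => v j / Num.sqrt (sqn d v))) (ramp T h k) -
        gauss_ramp x T h k v| + `|gauss_ramp x T h k v - mean_ramp x T h k|))).
      apply: ler_sum => k _; apply: le_trans (ler_normD _ _).
      by rewrite addrA subrK.
    rewrite big_split/=.
    have deI : 0 <= delta < 1 by rewrite (ltW de0)/= (le_lt_trans de1)// invf_lt1// ltr1n.
    have := ramp_radial T N n0 d0 h0 B0 deI xB radv.
    have : \sum_(k < N) `|gauss_ramp x T h k v - mean_ramp x T h k| <= eps / 10.
      apply: (@le_trans _ _ (\sum_(k < N) eta)); first by apply: ler_sum => k _; exact: allsmall.
      rewrite sumr_const card_ord -[eta *+ N]mulr_natl /eta le_eqVlt; apply/orP; left.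
      by apply/eqP; field; rewrite gt_eqF.
    by move: deB; lra.
  move=> /existsNP[k /negP]; rewrite -ltNge => kbad.
  rewrite (bigD1 k)//= {1}/bad kbad leeDl// sume_ge0//.
rewrite itintD; [|by []|by move=> v; exact: sume_ge0|by []|]; last first.
  by move=> d' Om c mc; apply: emeasurable_sum => k; exact: mbad.
rewrite EFinD; apply: leeD; first exact: radT.
rewrite itint_sum//.
apply: (@le_trans _ _ (\sum_(k < N)
    (2 * expR (- (eta ^+ 2 / (4 * (B / d%:R)))))%:E)%E).
  by apply: lee_sum => k _; exact: badT.
by rewrite sumEFin lee_fin sumr_const card_ord -[_ *+ N]mulr_natl.
Qed.

End Concentration.

(** * Choice of the grid and arithmetic of the constants *)

Section FinalEstimates.
Context {R : realType}.

Lemma powR_three_halves (e : R) : 0 < e -> powR e (3 / 2) = e * Num.sqrt e.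
Proof.
move=> e0; have -> : 3 / 2 = 1 + 2^-1 :> R by field.
rewrite powRD; last by rewrite gt_eqF// implybT.
by rewrite powRr1 ?(ltW e0)// powR12_sqrt// ltW.
Qed.

Lemma sqrt_pi_ge1 : 1 <= Num.sqrt (pi : R).
Proof. by rewrite -[leLHS]sqrtr1 ler_sqrt ?pi_gt0// (le_trans _ (pi_ge2 _)) ?ler1n. Qed.

Lemma sphere_prob_set0 d (S : set 'rV[R]_d) (p : R) : 0 <= p ->
  (forall theta, unit_sphere d theta -> ~ S theta) -> sphere_prob S <= p.
Proof.
move=> p0 S0; apply: (@sphere_prob_le _ _ _ (fun=> 0%E)) => //.
  by move=> v v1 Sv; exfalso; apply: (S0 _ _ Sv); rewrite /unit_sphere/= -[RHS]v1 -sqnorm_rowv.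
by rewrite itint_gauss_cst lee_fin.
Qed.

Lemma dBL_le2 d n (x : 'I_n -> 'rV[R]_d) (theta : 'rV[R]_d) (sigma : R) :
  (0 < n)%N -> 0 < sigma -> dBL_proj_normal x theta sigma <= 2.
Proof.
move=> n0 s0; rewrite leNgt; apply/negP => big.
have [|r [f [bf ->]]] := sup_gt _ big.
  exists 0; exists (fun=> 0); split.
    exists 0, 0; split; first by move=> y; rewrite normr0.
    by split; [move=> y z; rewrite subrr normr0 mul0r|rewrite addr0].
  rewrite /emp_proj_int big1// mulr0; under eq_integral do [].
  by rewrite integral0 subrr normr0.
rewrite ltNge => /negP; apply.
have [M [L [fM [fL ML]]]] := bf.
have L0 : 0 <= L.
  have := le_trans (normr_ge0 _) (fL 1 0).
  by rewrite subr0 normr1 mulr1.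
have bmf : bounded_measurable f by split; [exact: (lipschitz_measurable fL)|exists M].
rewrite normal_expect//.
have e1 : `|emp_proj_int x theta f| <= M.
  rewrite (le_trans (@norm_avg _ _ (fun i => f (dotp theta (x i)))))//.
  by rewrite -[leRHS](avg_cst M n0); apply: le_avg.
have e2 : `|\int[normal_prob 0 1]_z f (sigma * z)| <= M.
  by apply: norm_expect_le => [|z]; [exact: bounded_measurable_scale|exact: fM].
by rewrite (le_trans (ler_normB _ _))// (le_trans (lerD e1 e2))//; lra.
Qed.

(* z = sqrt (B / eps), so that z / eps = sqrt B / eps ^ (3/2), the half-width
   of the grid is T = 6 z, and N ~ 2 T / h = 16 z / eps for h = 3 eps / 4. *)
Lemma grid_bounds (z eps : R) : 0 < eps -> eps < 2 -> 1 <= z ->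
  exists N : nat, [/\ (0 < N)%N, 6 * z <= node (6 * z) (3 / 4 * eps) N &
    N%:R <= 18 * (z / eps)].
Proof.
move=> e0 e2 z1.
(* This lower bound absorbs the rounding up of N: 16 w + 1 <= 18 w for w = z / eps. *)
have ze : 2^-1 <= z / eps by rewrite ler_pdivlMr//; nra.
have ze0 : 0 <= 16 * (z / eps) by lra.
exists (Num.truncn (16 * (z / eps))).+1.
have /andP[t1 t2] := truncn_itv ze0.
split=> //.
- have E : 12 * z = 16 * (z / eps) * (3 / 4 * eps) by field; rewrite gt_eqF.
  have h : 16 * (z / eps) * (3 / 4 * eps) <=
      (Num.truncn (16 * (z / eps))).+1%:R * (3 / 4 * eps).
    by rewrite ler_wpM2r ?mulr_ge0 ?(ltW e0)// ltW.
  by rewrite /node; lra.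
- by rewrite -natr1; lra.
Qed.

(** Here D = d - 1. Both exponents are compared with the target exponent, and the prefactor 2 + 2 N
    <= 2 + 36 w is at most 40 w because w = z / eps >= 1/2. *)
Lemma tail_arith (D eps B z : R) (N : nat) :
  0 < D -> 0 < eps -> eps < 2 -> eps <= B -> z ^+ 2 = B / eps -> 1 <= z ->
  (0 < N)%N -> N%:R <= 18 * (z / eps) ->
  2 * expR (- ((D + 1) * (eps / (10 * Num.sqrt B)) ^+ 2 / 8)) +
  N%:R * (2 * expR (- ((eps / (10 * N%:R)) ^+ 2 / (4 * (B / (D + 1)))))) <=
  40 * (z / eps) * expR (- ((3 ^+ 2 * 2 ^+ 16)^-1 * D * eps ^+ 5 / B ^+ 2)).
Proof.
move=> D0 e0 e2 eB z2 z1 N0 Nle.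
have B0 : 0 < B by exact: lt_le_trans eB.
have NR : 0 < N%:R :> R by rewrite ltr0n.
have D1 : 0 < D + 1 by rewrite addr_gt0.
have ze : 2^-1 <= z / eps by rewrite ler_pdivlMr//; nra.
set X := (_ * D * eps ^+ 5 / B ^+ 2).
have w0 : 0 <= eps ^+ 2 / B by rewrite divr_ge0 ?sqr_ge0 ?(ltW B0).
(* This lets the norm tail, of order d eps^2 / B, absorb the target d eps^5 / B^2, whose extra
   factor is eps^3 / B. *)
have w4 : eps ^+ 3 / B <= 4.
  rewrite ler_pdivrMr//; have : eps ^+ 2 <= 4 by rewrite expr2; nra.
  by rewrite exprSr; have := sqr_ge0 eps; nra.
have c0 : 0 <= (3 ^+ 2 * 2 ^+ 16)^-1 :> R by rewrite invr_ge0.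
set c := (3 ^+ 2 * 2 ^+ 16)^-1 in X c0 *.
(* In the ramp exponent, 400 = 4 * 10^2 comes from eps / (10 N) and 324 = 18^2 from the bound on
   N. *)
have c1 : c <= 400^-1 * 324^-1.
  have p4 : 2 ^+ 4 = 16 :> R by ring.
  have p8 : 2 ^+ 8 = 256 :> R by rewrite (exprM 2 4 2) p4; ring.
  have p16 : 2 ^+ 16 = 256 * 256 :> R by rewrite (exprM 2 8 2) p8 expr2.
  have l0 : 0 < 400 * 324 :> R by apply: mulr_gt0; rewrite ltr0n.
  have le : 400 * 324 <= 3 ^+ 2 * (256 * 256) :> R by rewrite expr2; lra.
  rewrite /c p16 -invfM lef_pV2 ?posrE; [exact: le|exact: lt_le_trans le|exact: l0].
have x1 : X <= (D + 1) * (eps / (10 * Num.sqrt B)) ^+ 2 / 8.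
  have -> : (D + 1) * (eps / (10 * Num.sqrt B)) ^+ 2 / 8 = (D + 1) * (eps ^+ 2 / B) * 800^-1.
    rewrite exprMn exprVn exprMn sqr_sqrtr ?(ltW B0)//; field.
    by rewrite gt_eqF.
  have -> : X = c * (eps ^+ 3 / B) * (D * (eps ^+ 2 / B)).
    by rewrite /X; field; rewrite gt_eqF.
  apply: (@le_trans _ _ (c * 4 * (D * (eps ^+ 2 / B)))).
    apply: ler_wpM2r; first by apply: mulr_ge0 => //; exact: ltW.
    exact: ler_wpM2l.
  set w := eps ^+ 2 / B in w0 *.
  have w1 : D * w <= (D + 1) * w by rewrite ler_wpM2r// lerDl.
  have w2 : 0 <= D * w by rewrite mulr_ge0// ltW.
  have c2 : c * 4 <= 800^-1 by lra.
  by have := ler_wpM2r w2 c2; lra.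
have x2 : X <= (eps / (10 * N%:R)) ^+ 2 / (4 * (B / (D + 1))).
  have N2 : N%:R ^+ 2 <= 324 * (B / eps ^+ 3) :> R.
    have -> : 324 * (B / eps ^+ 3) = (18 * (z / eps)) ^+ 2.
      by rewrite !exprMn z2; field; rewrite gt_eqF.
    have ze18 : 0 <= 18 * (z / eps) by lra.
    by rewrite lerXn2r ?nnegrE.
  have -> : (eps / (10 * N%:R)) ^+ 2 / (4 * (B / (D + 1))) =
      400^-1 * (eps ^+ 2 / B) * (D + 1) * (N%:R ^+ 2)^-1.
    by field; rewrite !gt_eqF.
  have -> : X = c * 324 * (eps ^+ 2 / B) * D * (324 * (B / eps ^+ 3))^-1.
    by rewrite /X; field; rewrite !gt_eqF.
  have N20 : 0 < N%:R ^+ 2 :> R by rewrite exprn_gt0.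
  have uv : (324 * (B / eps ^+ 3))^-1 <= (N%:R ^+ 2)^-1.
    rewrite lef_pV2 ?posrE; [exact: N2|exact: lt_le_trans N20 N2|exact: N20].
  have u0 : 0 <= (324 * (B / eps ^+ 3))^-1.
    by rewrite invr_ge0 (le_trans (ltW N20) N2).
  set w := eps ^+ 2 / B in w0 *.
  have wD : 0 <= w * D by rewrite mulr_ge0// ltW.
  have c324 : c * 324 <= 400^-1 by lra.
  have c3240 : 0 <= c * 324 by apply: mulr_ge0; [exact: c0|exact: ler0n].
  apply: ler_pM; [by rewrite -mulrA; exact: mulr_ge0|exact: u0| |exact: uv].
  by have := ler_wpM2r wD c324; lra.
apply: (@le_trans _ _ (2 * expR (- X) + N%:R * (2 * expR (- X)))).
  apply: lerD; first by rewrite ler_wpM2l// ler_expR lerN2.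
  by rewrite ler_wpM2l ?(ltW NR)// ler_wpM2l// ler_expR lerN2.
rewrite mulrA -mulrDl ler_wpM2r ?expR_ge0//; lra.
Qed.

End FinalEstimates.

Theorem theorem3 (R : realType) (d n : nat) (x : 'I_n -> 'rV[R]_d)
    (sigma A B eps : R) :
  (2 <= d)%N -> (1 <= n)%N ->
  (exists i, x i != 0) ->
  0 < sigma ->
  n%:R^-1 * \sum_(i < n) sqnorm (x i) = sigma ^+ 2 * d%:R ->
  n%:R^-1 * \sum_(i < n) `| sigma ^-2 * sqnorm (x i) - d%:R | <= A ->
  (forall theta, unit_sphere d theta ->
     n%:R^-1 * \sum_(i < n) (dotp theta (x i)) ^+ 2 <= B) ->
  eps <= B ->
  Num.max (powR (3 * 2 ^+ 6 * pi * B / Num.sqrt (d%:R - 1)) (2 / 5))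
          (2 * (A + 2) / (d%:R - 1)) <= eps ->
  sphere_prob [set theta | dBL_proj_normal x theta sigma > eps]
    <= 48 * Num.sqrt pi * Num.sqrt B / powR eps (3 / 2)
       * expR (- ((3 ^+ 2 * 2 ^+ 16)^-1 * (d%:R - 1) * eps ^+ 5 / B ^+ 2)).
Proof.
move=> d2 n1 _ s0 avs avA xB eB; rewrite ge_max => /andP[_ epsA].
have d0 : (0 < d)%N by exact: leq_trans d2.
have dR : 0 < d%:R :> R by rewrite ltr0n.
have D0 : 0 < d%:R - 1 :> R by rewrite subr_gt0 ltr1n.
have A0 : 0 <= A.
  apply: le_trans avA; rewrite mulr_ge0 ?invr_ge0// sumr_ge0//.
have epsA' : 2 * (A + 2) <= eps * (d%:R - 1) by rewrite -ler_pdivrMr.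
have e0 : 0 < eps by rewrite (lt_le_trans _ epsA)// divr_gt0// mulr_gt0// ltr_wpDl.
have B0 : 0 < B by exact: lt_le_trans eB.
have se0 : 0 < Num.sqrt eps by rewrite sqrtr_gt0.
have sB0 : 0 < Num.sqrt B by rewrite sqrtr_gt0.
(* The distance never exceeds 2, so for eps >= 2 the event is empty; the grid estimates require eps
   < 2. *)
have [e2|e2] := leP 2 eps.
  apply: sphere_prob_set0.
    by rewrite !mulr_ge0 ?sqrtr_ge0 ?expR_ge0 ?invr_ge0 ?powR_ge0.
  move=> theta _ /=; apply/negP; rewrite -leNgt.
  exact: le_trans (dBL_le2 _ _ n1 s0) e2.
set X := expR _.
pose z := Num.sqrt B / Num.sqrt eps.
have z2 : z ^+ 2 = B / eps by rewrite exprMn exprVn !sqr_sqrtr ?(ltW e0) ?(ltW B0).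
have z1 : 1 <= z by rewrite /z ler_pdivlMr// mul1r ler_psqrt ?nnegrE ?(ltW e0) ?(ltW B0).
have z0 : 0 < z by exact: lt_le_trans z1.
have zE : Num.sqrt B / powR eps (3 / 2) = z / eps.
  by rewrite powR_three_halves// invfM mulrA mulrAC.
have [N [N0 TN Nle]] := grid_bounds e0 e2 z1.
(* The bound [B] summed over the d coordinate vectors compares the trace sigma^2 d with d B. *)
have sB : sigma ^+ 2 <= B.
  have E : \sum_(j < d) n%:R^-1 * \sum_(i < n) dotp (delta_mx 0 j) (x i) ^+ 2 =
      sigma ^+ 2 * d%:R.
    rewrite -avs -mulr_sumr exchange_big; congr (_ * _); apply: eq_bigr => i _.
    apply: eq_bigr => j _; congr (_ ^+ 2); rewrite /dotp (bigD1 j)//= big1 ?addr0.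
      by rewrite mxE !eqxx mul1r.
    by move=> k /negPf kj; rewrite mxE eqxx kj mul0r.
  rewrite -(ler_pM2r dR) -E.
  apply: (@le_trans _ _ (\sum_(j < d) B)); last first.
    by rewrite sumr_const card_ord mulr_natr.
  apply: ler_sum => j _; apply: xB.
  rewrite /unit_sphere/= /sqnorm (bigD1 j)//= big1 ?addr0.
    by rewrite mxE !eqxx expr1n.
  by move=> k /negPf kj; rewrite mxE eqxx kj expr0n.
have Ae : A <= eps * d%:R / 2 by rewrite ler_pdivlMr//; lra.
have T0 : 0 < 6 * z by rewrite mulr_gt0.
have T2 : (6 * z) ^+ 2 = 36 * B / eps by rewrite exprMn z2; field; rewrite gt_eqF.
(* The largest relative error of the norm whose cost delta sqrt B stays within eps / 10. *)
pose delta := eps / (10 * Num.sqrt B).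
have de0 : 0 < delta by rewrite /delta divr_gt0// mulr_gt0.
have eB2 : eps <= 2 * Num.sqrt B.
  rewrite -(@ler_pXn2r _ 2) ?nnegrE ?mulr_ge0 ?sqrtr_ge0 ?(ltW e0)//.
  by rewrite exprMn sqr_sqrtr ?(ltW B0)// expr2; nra.
have de1 : delta <= 2^-1 by rewrite /delta ler_pdivrMr ?mulr_gt0//; lra.
have deB : delta * Num.sqrt B <= eps / 10.
  rewrite le_eqVlt; apply/orP; left; apply/eqP; rewrite /delta; field.
  by rewrite gt_eqF.
have tail := sphere_dBL_tail d0 n1 s0 e0 B0 T0 avs avA xB sB Ae T2 TN N0 de0 de1 deB.
apply: (le_trans tail).
have := tail_arith D0 e0 e2 eB z2 z1 N0 Nle; rewrite subrK => ar.
apply: (le_trans ar); rewrite -/X -[48 * _ * _ / _]mulrA zE.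
rewrite ler_wpM2r ?expR_ge0// ler_wpM2r ?divr_ge0 ?(ltW z0) ?(ltW e0)//.
(* The prefactor reached is 40, below 48 sqrt pi. *)
have := sqrt_pi_ge1 (R := R); lra.
Qed.
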